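(* Let $A$ be an Artinian ring and let $\varphi\in\mathrm{SA}_2(A)$. Then $\varphi$ is stably a composition of elementary automorphisms, i.e., $\varphi^{[m]}\in\mathrm{EA}_{2+m}(A)$ for some $m\ge0$. If $A$ is a $\mathbb Q$-algebra, then more strongly $\varphi\in\mathrm{EA}_2(A)$.
   Context: ''Ring'' means commutative ring with identity. For a ring $R$, $\mathrm{GA}_n(R)$ is the group of polynomial automorphisms of affine $n$-space over $R$: its elements are vectors $\varphi=(F_1,\ldots,F_n)\in R[X_1,\ldots,X_n]^n$ which are invertible under composition (where $\varphi\circ\psi$ is obtained by substituting the components of $\psi$ for $X_1,\dots,X_n$ in $\varphi$), with identity $(X_1,\ldots,X_n)$. $\mathrm{SA}_n(R)$ is the subgroup of all $\varphi\in\mathrm{GA}_n(R)$ whose Jacobian determinant is $1$. An elementary automorphism is one of the form $e_i(f)=(X_1,\ldots,X_{i-1},X_i+f,X_{i+1},\ldots,X_n)$ with $f\in R[X_1,\ldots,X_{i-1},X_{i+1},\ldots,X_n]$; $\mathrm{EA}_n(R)$ is the subgroup of $\mathrm{GA}_n(R)$ generated by these. For $m\ge 0$, $\varphi^{[m]}=(F_1,\ldots,F_n,X_{n+1},\ldots,X_{n+m})\in\mathrm{GA}_{n+m}(R)$. *)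

(* Defs.v *)
From HB Require Import structures.
From mathcomp Require Import all_boot all_order all_algebra.
From mathcomp Require Export mpoly.

Set Implicit Arguments.
Unset Strict Implicit.
Unset Printing Implicit Defensive.

Import GRing.Theory.

Local Open Scope ring_scope.

(* Ideals are Prop-valued, and the unit ideal is allowed: the library's
   [idealr] only covers proper ideals with a boolean membership test. *)
Definition is_ideal (R : comNzRingType) (I : R -> Prop) : Prop :=
  [/\ I 0,
      forall x y, I x -> I y -> I (x + y)
    & forall a x, I x -> I (a * x)].

Definition artinian (R : comNzRingType) : Prop :=
  forall I : nat -> R -> Prop,
    (forall k, is_ideal (I k)) ->
    (forall k x, I k.+1 x -> I k x) ->
    exists N, forall k, (N <= k)%N -> forall x, I k x <-> I N x.

Definition Q_algebra (R : comNzRingType) : Prop :=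
  inhabited {rmorphism rat -> R}.

(* A vector (F_1, ..., F_n) of polynomials in n variables. *)
Notation polymap R n := (n.-tuple {mpoly R[n]}).

Section PolynomialAutomorphisms.
Variable R : comNzRingType.

Definition pm_id (n : nat) : polymap R n := [tuple 'X_i | i < n].

Definition pm_comp (n : nat) (phi psi : polymap R n) : polymap R n :=
  [tuple tnth phi i \mPo psi | i < n].

Definition pm_inverse (n : nat) (phi psi : polymap R n) : Prop :=
  pm_comp phi psi = pm_id n /\ pm_comp psi phi = pm_id n.

Definition GA (n : nat) (phi : polymap R n) : Prop :=
  exists psi : polymap R n, pm_inverse phi psi.

Definition jacobian (n : nat) (phi : polymap R n) : 'M[{mpoly R[n]}]_n :=
  \matrix_(i, j) (tnth phi i)^`M(j).

Definition SA (n : nat) (phi : polymap R n) : Prop :=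
  GA phi /\ \det (jacobian phi) = 1.

(* The polynomials of R[X_1, ..., X_(i-1), X_(i+1), ..., X_n], seen inside
   R[X_1, ..., X_n]. *)
Definition free_of_var (n : nat) (i : 'I_n) (f : {mpoly R[n]}) : Prop :=
  forall m : 'X_{1..n}, m \in msupp f -> m i = 0%N.

Definition elementary (n : nat) (i : 'I_n) (f : {mpoly R[n]}) : polymap R n :=
  [tuple if j == i then 'X_j + f else 'X_j | j < n].

(* The subgroup generated by the elementary automorphisms; every constructor
   stays inside GA. *)
Inductive EA (n : nat) : polymap R n -> Prop :=
| EA_id : EA (pm_id n)
| EA_elementary (i : 'I_n) (f : {mpoly R[n]}) :
    free_of_var i f -> EA (elementary i f)
| EA_comp (phi psi : polymap R n) : EA phi -> EA psi -> EA (pm_comp phi psi)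
| EA_inv (phi psi : polymap R n) : EA phi -> pm_inverse phi psi -> EA psi.

Definition stabilize (m n : nat) (phi : polymap R n) : polymap R (n + m) :=
  [tuple match split i with
         | inl j => tnth phi j \mPo [tuple 'X_(lshift m k) | k < n]
         | inr _ => 'X_i
         end | i < n + m].

End PolynomialAutomorphisms.

(* Main.v *)
Require Import Defs.
From HB Require Import structures.
From Stdlib Require Import Classical ClassicalEpsilon.
From mathcomp Require Import all_boot all_order all_algebra all_fingroup.
From mathcomp Require Import mpoly generic_quotient ring_quotient.
From mathcomp Require Import zify ring.

(* Over a field k the theorem of Jung and van der Kulk applies. Its proof here,
   valid in every characteristic, views an automorphism (p, q) of the plane
   inside k[t][z] via x = t z, y = z. If neither of deg p, deg q divides the
   other, MacLane's construction produces key polynomials starting from q, p.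
   The Jacobian condition gives, to leading order, the brackets of the key
   polynomials, and the bound deg {f, g} <= deg f + deg g - 1 then shows that
   their degrees never drop to 1; hence x and y cannot lie in k[p, q].
   So one of deg p, deg q can be lowered by an elementary map until (p, q) is
   affine.

   Over an Artinian ring A, the residue fields are handled one at a time: a
   minimal ideal I such that phi is elementary modulo I is nil, since otherwise
   it contains an idempotent outside some maximal ideal m and phi is also
   elementary modulo the intersection of I and m. Next I is replaced by its
   square. Modulo that square phi is x + V with div V = 0. With an extra
   variable z, V is a sum of fields -a g d/dx_i + a z (dg/dx_i) d/dz, and each
   of these comes from a commutator of x_i + a z and z + g. Over Q and in two
   variables, V is Hamiltonian, and a y^k x^s is obtained from
   a (y + x^s)^(k+1) by induction on k. In an Artinian ring a nil ideal that
   equals its square vanishes. *)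

Set Implicit Arguments.
Unset Strict Implicit.
Unset Printing Implicit Defensive.

Import GRing.Theory.
Local Open Scope ring_scope.

(** Let U be the current key polynomial, F the representative of largest degree, and a the order of
    dg U modulo the degrees found so far. For a suitable g, q {g, U} has degree dg g + dg F + 1,
    while {g, U} has degree at most dg g + dg U - 1; hence dg U >= dg F + 2 - dg q. The next stage
    adds (a - 1) dg U to dg F and strictly lowers dg U - dg F, so the chain stops. It can only stop
    because the leading coefficients to be compared are no longer proportional over k, and then
    expansions in powers of U ^ a have no cancellation in top degree. Over an Artinian ring the
    chain condition is applied to the ideals modulo which the map is already elementary; this
    replaces a decomposition into local rings and the nilpotency of the radical. The induction for
    Hamiltonian fields divides by k + 1, which requires a Q-algebra. In general the new variable z
    absorbs the divergence of each summand of V instead, at the price of one variable for each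
    squaring of the ideal. *)

Local Notation dg f := (size f).-1.
Local Notation i0 := (ord0 : 'I_2).
Local Notation i1 := (lift ord0 ord0 : 'I_2).

(** * Composition, Jacobians and elementary automorphisms *)

Lemma mpoly_ring_ind (R : comNzRingType) (n : nat) (P : {mpoly R[n]} -> Prop) :
  (forall c, P c%:MP) -> (forall i, P 'X_i) ->
  (forall p q, P p -> P q -> P (p + q)) ->
  (forall p q, P p -> P q -> P (p * q)) -> forall p, P p.
Proof.
move=> PC PX PD PM; apply: mpolyind => [|c m p _ _ Pp].
  by rewrite -mpolyC0.
apply: PD => //; rewrite -mul_mpolyC; apply: (PM _ _) => //; rewrite mpolyXE_id.
apply: big_ind => [|p1 p2|i _]; [by rewrite -mpolyC1 | exact: PM |].
elim: (m i) => [|j IH]; first by rewrite expr0 -mpolyC1.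
by rewrite exprS; apply: PM.
Qed.

Lemma mderivXi (R : comNzRingType) (n : nat) (i j : 'I_n) :
  ('X_i : {mpoly R[n]})^`M(j) = (i == j)%:R.
Proof.
rewrite mderivX mnm1E; case: eqP => [->|_]; last by rewrite scale0r.
rewrite scale1r -mpolyX0; congr 'X_[_].
by apply/mnmP => l; rewrite mnmBE subnn mnm0E.
Qed.

Section PolyMaps.
Variable R : comNzRingType.
Implicit Types (n : nat).

Lemma comp_mpolyXi n k (lq : n.-tuple {mpoly R[k]}) (i : 'I_n) :
  'X_i \mPo lq = tnth lq i.
Proof. by rewrite comp_mpolyXU -tnth_nth. Qed.

Lemma comp_mpolyM n k (lq : n.-tuple {mpoly R[k]}) p q :
  (p * q) \mPo lq = (p \mPo lq) * (q \mPo lq).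
Proof. exact: rmorphM. Qed.

Lemma comp_mpolyA n k l (p : {mpoly R[n]}) (lq : n.-tuple {mpoly R[k]})
    (lr : k.-tuple {mpoly R[l]}) :
  (p \mPo lq) \mPo lr = p \mPo [tuple tnth lq i \mPo lr | i < n].
Proof.
elim/mpoly_ring_ind: p => [c|i|p q IHp IHq|p q IHp IHq].
- by rewrite !comp_mpolyC.
- by rewrite !comp_mpolyXi tnth_mktuple.
- by rewrite !comp_mpolyD IHp IHq.
- by rewrite !comp_mpolyM IHp IHq.
Qed.

Lemma tnth_pm_id n i : tnth (pm_id R n) i = 'X_i.
Proof. exact: tnth_mktuple. Qed.

Lemma tnth_pm_comp n (phi psi : polymap R n) i :
  tnth (pm_comp phi psi) i = tnth phi i \mPo psi.
Proof. exact: tnth_mktuple. Qed.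

Lemma tnth_elementary n i (f : {mpoly R[n]}) j :
  tnth (elementary i f) j = if j == i then 'X_j + f else 'X_j.
Proof. exact: tnth_mktuple. Qed.

Lemma pm_compA n (phi psi chi : polymap R n) :
  pm_comp phi (pm_comp psi chi) = pm_comp (pm_comp phi psi) chi.
Proof.
apply: eq_from_tnth => i; rewrite !tnth_pm_comp comp_mpolyA.
by congr (_ \mPo _); apply: eq_from_tnth => j; rewrite !tnth_mktuple.
Qed.

Lemma pm_comp_id n (phi : polymap R n) : pm_comp phi (pm_id R n) = phi.
Proof. by apply: eq_from_tnth => i; rewrite tnth_pm_comp comp_mpoly_id. Qed.

Lemma pm_id_comp n (phi : polymap R n) : pm_comp (pm_id R n) phi = phi.
Proof.
by apply: eq_from_tnth => i; rewrite tnth_pm_comp tnth_pm_id comp_mpolyXi.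
Qed.

Lemma pm_inverse_id n : pm_inverse (pm_id R n) (pm_id R n).
Proof. by split; rewrite pm_comp_id. Qed.

Lemma pm_inverse_sym n (phi psi : polymap R n) :
  pm_inverse phi psi -> pm_inverse psi phi.
Proof. by case. Qed.

Lemma pm_inverse_comp n (phi phi' psi psi' : polymap R n) :
  pm_inverse phi phi' -> pm_inverse psi psi' ->
  pm_inverse (pm_comp phi psi) (pm_comp psi' phi').
Proof.
move=> [h1 h2] [h3 h4]; split.
  by rewrite pm_compA -(pm_compA phi) h3 pm_comp_id.
by rewrite pm_compA -(pm_compA psi') h2 pm_comp_id.
Qed.

Lemma pm_inverse_uniq n (phi psi psi' : polymap R n) :
  pm_inverse phi psi -> pm_inverse phi psi' -> psi = psi'.
Proof.
by move=> [_ h] [h' _]; rewrite -(pm_comp_id psi) -h' pm_compA h pm_id_comp.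
Qed.

Lemma comp_free_of_var n k (i : 'I_n) (f : {mpoly R[n]}) (l l' : n.-tuple {mpoly R[k]}) :
  free_of_var i f -> (forall j, j != i -> tnth l j = tnth l' j) ->
  f \mPo l = f \mPo l'.
Proof.
move=> fi hl; rewrite !comp_mpolyE; apply: eq_big_seq => m hm; congr (_ *: _).
apply: eq_bigr => j _; case: (eqVneq j i) => [->|ji]; last by rewrite hl.
by rewrite fi // !expr0.
Qed.

Lemma comp_free_elementary n (i : 'I_n) (f g : {mpoly R[n]}) :
  free_of_var i f -> f \mPo elementary i g = f.
Proof.
move=> fi; rewrite (comp_free_of_var (l' := pm_id R n) fi) ?comp_mpoly_id //.
by move=> j ji; rewrite tnth_elementary tnth_pm_id (negbTE ji).
Qed.

Lemma free_of_varE n (i : 'I_n) (f : {mpoly R[n]}) :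
  (forall m : 'X_{1..n}, m i != 0%N -> f@_m = 0) -> free_of_var i f.
Proof.
by move=> h m; rewrite mcoeff_msupp => fm; apply/eqP; apply: contraNT fm => /h ->.
Qed.

Lemma free_of_var_coef n (i : 'I_n) (f : {mpoly R[n]}) (m : 'X_{1..n}) :
  free_of_var i f -> m i != 0%N -> f@_m = 0.
Proof.
by move=> fi; apply: contraNeq; rewrite -mcoeff_msupp => /fi ->.
Qed.

Lemma free_of_varN n (i : 'I_n) (f : {mpoly R[n]}) :
  free_of_var i f -> free_of_var i (- f).
Proof.
by move=> fi; apply: free_of_varE => m mi; rewrite mcoeffN (free_of_var_coef fi) ?oppr0.
Qed.

Lemma free_of_varD n (i : 'I_n) (f g : {mpoly R[n]}) :
  free_of_var i f -> free_of_var i g -> free_of_var i (f + g).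
Proof.
move=> fi gi; apply: free_of_varE => m mi.
by rewrite mcoeffD (free_of_var_coef fi) // (free_of_var_coef gi) // addr0.
Qed.

Lemma free_of_varC n (i : 'I_n) (c : R) : free_of_var i c%:MP.
Proof.
apply: free_of_varE => m mi; rewrite mcoeffC; case: eqP => [h|_]; last by rewrite mulr0.
by move: mi; rewrite h mnmE.
Qed.

Lemma free_of_varZ n (i : 'I_n) (c : R) (f : {mpoly R[n]}) :
  free_of_var i f -> free_of_var i (c *: f).
Proof.
move=> fi; apply: free_of_varE => m mi.
by rewrite mcoeffZ (free_of_var_coef fi) // mulr0.
Qed.

Lemma free_of_varX n (i : 'I_n) (m : 'X_{1..n}) :
  m i = 0%N -> free_of_var i ('X_[m] : {mpoly R[n]}).
Proof. by move=> mi m'; rewrite msuppX inE => /eqP ->. Qed.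

Lemma mderiv_free n (i : 'I_n) (f : {mpoly R[n]}) :
  free_of_var i f -> f^`M(i) = 0.
Proof.
move=> fi; apply/mpolyP => m; rewrite mcoeff_mderiv mcoeff0 (free_of_var_coef fi) ?mul0rn //.
by rewrite mnmDE mnm1E eqxx addn1.
Qed.

Lemma elementary_inverse n (i : 'I_n) (f : {mpoly R[n]}) :
  free_of_var i f -> pm_inverse (elementary i f) (elementary i (- f)).
Proof.
have aux (g : {mpoly R[n]}) : free_of_var i g -> pm_comp (elementary i g) (elementary i (- g)) = pm_id R n.
  move=> gi; apply: eq_from_tnth => j; rewrite tnth_pm_comp tnth_pm_id tnth_elementary.
  case: eqP => [->|/eqP ji]; last by rewrite comp_mpolyXi tnth_elementary (negbTE ji).
  by rewrite comp_mpolyD comp_mpolyXi tnth_elementary eqxx comp_free_elementary // addrNK.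
move=> fi; split; first exact: aux.
by rewrite -{2}(opprK f); apply: aux; apply: free_of_varN.
Qed.

Lemma EA_GA n (phi : polymap R n) : EA phi -> GA phi.
Proof.
elim=> [|i f fi|f g _ [f' hf] _ [g' hg]|f g _ _ hfg].
- by exists (pm_id R n); apply: pm_inverse_id.
- by exists (elementary i (- f)); apply: elementary_inverse.
- by exists (pm_comp g' f'); apply: pm_inverse_comp.
- by exists f; apply: pm_inverse_sym.
Qed.

Lemma EA_cancel n (eps phi : polymap R n) :
  EA eps -> EA (pm_comp eps phi) -> EA phi.
Proof.
move=> he h; have [eps' inv] := EA_GA he.
have -> : phi = pm_comp eps' (pm_comp eps phi).
  by rewrite pm_compA inv.2 pm_id_comp.
by apply: EA_comp h; apply: EA_inv he inv.
Qed.

Lemma mderiv_comp n k (f : {mpoly R[n]}) (lq : n.-tuple {mpoly R[k]}) j :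
  (f \mPo lq)^`M(j) = \sum_i (f^`M(i) \mPo lq) * (tnth lq i)^`M(j).
Proof.
elim/mpoly_ring_ind: f => [c|i|p q IHp IHq|p q IHp IHq].
- rewrite comp_mpolyC mderivC big1 // => i _.
  by rewrite mderivC comp_mpoly0 mul0r.
- rewrite comp_mpolyXi (bigD1 i) //= big1 ?addr0.
    by rewrite mderivXi eqxx comp_mpoly1 mul1r.
  by move=> l li; rewrite mderivXi eq_sym (negbTE li) comp_mpoly0 mul0r.
- rewrite comp_mpolyD mderivD IHp IHq -big_split /=; apply: eq_bigr => i _.
  by rewrite mderivD comp_mpolyD mulrDl.
- rewrite comp_mpolyM mderivM IHp IHq mulr_suml mulr_sumr -big_split /=.
  apply: eq_bigr => i _; rewrite mderivM comp_mpolyD !comp_mpolyM; ring.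
Qed.

Lemma jacobian_comp n (phi psi : polymap R n) :
  jacobian (pm_comp phi psi) =
    map_mx (comp_mpoly psi) (jacobian phi) *m jacobian psi.
Proof.
apply/matrixP => i j; rewrite !mxE tnth_pm_comp mderiv_comp.
by apply: eq_bigr => l _; rewrite !mxE.
Qed.

Lemma det_jacobian_comp n (phi psi : polymap R n) :
  \det (jacobian (pm_comp phi psi)) =
    (\det (jacobian phi) \mPo psi) * \det (jacobian psi).
Proof. by rewrite jacobian_comp det_mulmx det_map_mx. Qed.

Lemma jacobian_id n : jacobian (pm_id R n) = 1%:M.
Proof.
by apply/matrixP => i j; rewrite !mxE tnth_pm_id mderivXi.
Qed.

(** Row i is a unit row plus the gradient of f. By multilinearity the determinant is 1 plus that of
    a matrix whose column i vanishes. *)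
Lemma det_jacobian_elementary n (i : 'I_n) (f : {mpoly R[n]}) :
  free_of_var i f -> \det (jacobian (elementary i f)) = 1.
Proof.
move=> fi.
pose C : 'M[{mpoly R[n]}]_n := \matrix_(j, l) if j == i then f^`M(l) else (j == l)%:R.
rewrite (@determinant_multilinear _ _ _ 1%:M C i 1 1).
- rewrite det1 mul1r mul1r (expand_det_col C i) big1 ?addr0 // => j _.
  by rewrite mxE; case: eqP => [->|_]; rewrite ?mderiv_free // mul0r.
- by apply/rowP => l; rewrite !mxE tnth_elementary eqxx !mul1r /= mderivD mderivXi.
- by apply/matrixP => j l; rewrite !mxE tnth_elementary [lift i j == i]eq_sym (negbTE (neq_lift i j)) mderivXi.
- by apply/matrixP => j l; rewrite !mxE tnth_elementary [lift i j == i]eq_sym (negbTE (neq_lift i j)) mderivXi.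
Qed.

Lemma det_jacobian_EA n (phi : polymap R n) :
  EA phi -> \det (jacobian phi) = 1.
Proof.
elim=> [|i f fi|f g _ hf _ hg|f g _ hf [hfg _]].
- by rewrite jacobian_id det1.
- exact: det_jacobian_elementary.
- by rewrite det_jacobian_comp hf hg comp_mpoly1 mulr1.
- have := det_jacobian_comp f g.
  by rewrite hfg jacobian_id det1 hf comp_mpoly1 mul1r.
Qed.
End PolyMaps.

(** * Change of coefficient ring *)

Section MapPolyMaps.
Variables (R Q : comNzRingType) (pi : {rmorphism R -> Q}).
Implicit Types (n : nat).

Lemma map_mpoly_Xi n (i : 'I_n) : map_mpoly pi 'X_i = 'X_i.
Proof. exact: map_mpolyX. Qed.

Lemma map_mpoly_mPo n k (f : {mpoly R[n]}) (lq : n.-tuple {mpoly R[k]}) :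
  map_mpoly pi (f \mPo lq) =
    map_mpoly pi f \mPo [tuple map_mpoly pi (tnth lq i) | i < n].
Proof.
elim/mpoly_ring_ind: f => [c|i|p q IHp IHq|p q IHp IHq].
- by rewrite comp_mpolyC !map_mpolyC comp_mpolyC.
- by rewrite map_mpoly_Xi !comp_mpolyXi tnth_mktuple.
- by rewrite !rmorphD /= IHp IHq.
- by rewrite !rmorphM /= IHp IHq.
Qed.

Lemma map_mpoly_mderiv n (f : {mpoly R[n]}) i :
  map_mpoly pi f^`M(i) = (map_mpoly pi f)^`M(i).
Proof.
by apply/mpolyP => m; rewrite mcoeff_map_mpoly !mcoeff_mderiv mcoeff_map_mpoly; exact: raddfMn.
Qed.

Definition pm_map n (phi : polymap R n) : polymap Q n :=
  [tuple map_mpoly pi (tnth phi i) | i < n].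

Lemma tnth_pm_map n (phi : polymap R n) i :
  tnth (pm_map phi) i = map_mpoly pi (tnth phi i).
Proof. exact: tnth_mktuple. Qed.

Lemma pm_map_id n : pm_map (pm_id R n) = pm_id Q n.
Proof.
by apply: eq_from_tnth => i; rewrite tnth_pm_map !tnth_pm_id map_mpoly_Xi.
Qed.

Lemma pm_map_comp n (phi psi : polymap R n) :
  pm_map (pm_comp phi psi) = pm_comp (pm_map phi) (pm_map psi).
Proof.
by apply: eq_from_tnth => i; rewrite tnth_pm_map !tnth_pm_comp map_mpoly_mPo tnth_pm_map.
Qed.

Lemma pm_map_inverse n (phi psi : polymap R n) :
  pm_inverse phi psi -> pm_inverse (pm_map phi) (pm_map psi).
Proof. by case=> h1 h2; split; rewrite -pm_map_comp ?h1 ?h2 pm_map_id. Qed.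

Lemma det_jacobian_map n (phi : polymap R n) :
  \det (jacobian (pm_map phi)) = map_mpoly pi (\det (jacobian phi)).
Proof.
rewrite -det_map_mx; congr (\det _); apply/matrixP => i j.
by rewrite !mxE tnth_pm_map -map_mpoly_mderiv.
Qed.

Lemma SA_map n (phi : polymap R n) : SA phi -> SA (pm_map phi).
Proof.
case=> [[psi hpsi] hdet]; split; first by exists (pm_map psi); apply: pm_map_inverse.
by rewrite det_jacobian_map hdet rmorph1.
Qed.

Lemma pm_map_elementary n (i : 'I_n) (f : {mpoly R[n]}) :
  pm_map (elementary i f) = elementary i (map_mpoly pi f).
Proof.
apply: eq_from_tnth => j; rewrite tnth_pm_map !tnth_elementary.
by case: eqP => _; rewrite ?rmorphD /= map_mpoly_Xi.
Qed.

End MapPolyMaps.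

(** * The bracket on T[z] *)

Section Degree.
Variable T : idomainType.
Implicit Types f g : {poly T}.

Lemma size_prod_le f g a b :
  (size f <= a)%N -> (size g <= b.+1)%N -> (size (f * g)%R <= a + b)%N.
Proof. by move=> ha hb; apply: leq_trans (size_polyMleq _ _) _; lia. Qed.

Lemma size_sum_le f g a :
  (size f <= a)%N -> (size g <= a)%N -> (size (f + g)%R <= a)%N.
Proof. by move=> ha hb; apply: leq_trans (size_polyD _ _) _; lia. Qed.

Lemma size_sub_le f g a :
  (size f <= a)%N -> (size g <= a)%N -> (size (f - g)%R <= a)%N.
Proof. by move=> ha hb; apply: size_sum_le; rewrite ?size_polyN. Qed.

Lemma size_mulrn_le f m a : (size f <= a)%N -> (size (f *+ m)%R <= a)%N.
Proof. by move=> h; rewrite -scaler_nat; apply: leq_trans (size_scale_leq _ _) h. Qed.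

Lemma size_dg f : f != 0 -> size f = (dg f).+1.
Proof. by rewrite -size_poly_gt0; case: (size f). Qed.

Lemma dgM f g : f != 0 -> g != 0 -> dg (f * g) = (dg f + dg g)%N.
Proof.
move=> f0 g0; rewrite size_mul //.
move: f0 g0; rewrite -!size_poly_gt0; lia.
Qed.

Lemma dgX f m : dg (f ^+ m) = (m * dg f)%N.
Proof. by rewrite size_exp mulnC. Qed.

Lemma size_sub_lead f g : dg f = dg g -> lead_coef f = lead_coef g ->
  (size (f - g)%R <= dg f)%N.
Proof.
move=> dfg lfg; apply/leq_sizeP => j hj; rewrite coefB.
case: (ltngtP j (dg f)) => [|hj'|->]; first by rewrite ltnNge hj.
  rewrite !nth_default ?subr0 //.
    by apply: leq_trans (leqSpred _) _; rewrite -dfg.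
  exact: leq_trans (leqSpred _) hj'.
by rewrite {2}dfg -!lead_coefE lfg subrr.
Qed.

End Degree.

Section Bracket.
Variables (T : idomainType) (D : {additive T -> T}).
Hypothesis DM : forall a b, D (a * b) = D a * b + a * D b.
Local Notation B := {poly T}.
Implicit Types f g h : B.

Definition coef_deriv f : B := map_poly D f.

Lemma coef_coef_deriv f i : (coef_deriv f)`_i = D f`_i.
Proof. exact: coef_map. Qed.

Lemma coef_derivD f g : coef_deriv (f + g) = coef_deriv f + coef_deriv g.
Proof. exact: raddfD. Qed.

Lemma coef_derivN f : coef_deriv (- f) = - coef_deriv f.
Proof. exact: raddfN. Qed.

Lemma coef_derivM f g :
  coef_deriv (f * g) = coef_deriv f * g + f * coef_deriv g.
Proof.
apply/polyP => i; rewrite coefD coef_coef_deriv !coefM raddf_sum -big_split /=.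
by apply: eq_bigr => j _; rewrite DM !coef_coef_deriv.
Qed.

Lemma coef_derivC (c : T) : coef_deriv c%:P = (D c)%:P.
Proof. exact: map_polyC. Qed.

Lemma size_coef_deriv f : (size (coef_deriv f) <= size f)%N.
Proof. exact: size_poly. Qed.

(* The Jacobian of (t, z) |-> (g, f), for f, g in T[z] and D = d/dt on T. *)
Definition br f g : B := f^`() * coef_deriv g - coef_deriv f * g^`().

Lemma brC f g : br f g = - br g f.
Proof. rewrite /br; ring. Qed.

Lemma brff f : br f f = 0.
Proof. rewrite /br; ring. Qed.

Lemma brDr f g h : br f (g + h) = br f g + br f h.
Proof. rewrite /br derivD coef_derivD; ring. Qed.

Lemma brNr f g : br f (- g) = - br f g.
Proof. rewrite /br derivN coef_derivN; ring. Qed.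

Lemma brMl f g h : br (f * g) h = f * br g h + g * br f h.
Proof. rewrite /br derivM coef_derivM; ring. Qed.

Lemma brMr f g h : br f (g * h) = g * br f h + h * br f g.
Proof. rewrite /br derivM coef_derivM; ring. Qed.

Lemma br_cstr f (c : T) : D c = 0 -> br f c%:P = 0.
Proof. by move=> Dc; rewrite /br coef_derivC Dc !derivC polyC0; ring. Qed.

Lemma br0r f : br f 0 = 0.
Proof. by rewrite -polyC0 br_cstr ?raddf0. Qed.

Lemma br1l f : br 1 f = 0.
Proof.
have D1 : D 1 = 0.
  have := DM 1 1; rewrite !mulr1 mul1r => /eqP.
  by rewrite -subr_eq0 opprD addrA subrr sub0r oppr_eq0 => /eqP.
by rewrite brC -polyC1 br_cstr ?oppr0.
Qed.

Lemma brXl f m g : br (f ^+ m.+1) g = f ^+ m * br f g *+ m.+1.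
Proof.
elim: m => [|m IH]; first by rewrite expr1 expr0 mul1r mulr1n.
by rewrite exprS brMl IH exprS; ring.
Qed.

Lemma brXr f g m : br f (g ^+ m.+1) = g ^+ m * br f g *+ m.+1.
Proof. by rewrite brC brXl (brC g) mulrN mulNrn opprK. Qed.

(** Each product contains one z-derivative, which lowers the degree, while [coef_deriv] does not
    raise it. *)
Lemma size_br f g : (size (br f g) <= dg f + dg g)%N.
Proof.
rewrite /br; have Hd h : (size h^`() <= dg h)%N.
  case: (eqVneq h 0) => [->|h0]; first by rewrite deriv0 size_poly0.
  by have := lt_size_deriv h0; lia.
have Hc h : (size (coef_deriv h) <= (dg h).+1)%N.
  exact: leq_trans (size_coef_deriv h) (leqSpred _).
apply: size_sub_le; first exact: size_prod_le.
by rewrite mulrC addnC; apply: size_prod_le.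
Qed.

End Bracket.

(** * Chains of key polynomials *)

Section KeyPolynomials.
Variables (T : idomainType) (D : {additive T -> T}).
Hypothesis DM : forall a b, D (a * b) = D a * b + a * D b.
Variables (k : fieldType) (iota : {rmorphism k -> T}).
Hypothesis Diota : forall c, D (iota c) = 0.
Variables (L : comNzRingType) (E : {rmorphism {poly L} -> {poly T}}).
Variables (qL : L) (cL : k -> L).
Hypothesis EcL : forall c, E (cL c)%:P = (iota c)%:P.
Local Notation B := {poly T}.
Local Notation br := (br D).
Local Notation q := (E qL%:P).
Local Notation z := ('X : B).

(* State of a MacLane-style chain of key polynomials for the z-degree on
   k[p, q], where p = E 'X and q = E qL. Elements of G are products of the key
   polynomials found so far; E SU is the next one, of degree d in p over k[q].
   The E (SF l) represent all classes of degrees of G modulo dg q, and F is the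
   one of largest degree. To leading order, q {g, U} = (dg g / e) z g F; since
   e is the gcd of the degrees of G, this stays meaningful in characteristic p,
   where derivatives with respect to p or q may vanish. *)
Record stage (G : B -> Prop) (e d : nat) (SF : nat -> {poly L}) (F : B)
    (SU : {poly L}) : Prop := Stage {
  stage_G1 : G 1;
  stage_Gq : G q;
  stage_GM : forall g h, G g -> G h -> G (g * h);
  stage_Gn0 : forall g, G g -> g != 0;
  stage_e : (0 < e)%N;
  stage_d : (0 < d)%N;
  stage_q : dg q = (d * e)%N;
  stage_dvd : forall g, G g -> (e %| dg g)%N;
  stage_lc : forall g h, G g -> G h -> dg g = dg h ->
    exists2 c, c != 0 & lead_coef g = iota c * lead_coef h;
  stage_SFm : forall l, (l < d)%N -> SF l \is monic;
  stage_SFs : forall l, (l < d)%N -> size (SF l) = l.+1;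
  stage_SFG : forall l, (l < d)%N -> G (E (SF l));
  stage_SFF : forall l, (l < d)%N -> (dg (E (SF l)) <= dg F)%N;
  stage_inj : forall l l', (l < d)%N -> (l' < d)%N ->
    dg (E (SF l)) = dg (E (SF l')) %[mod dg q] -> l = l';
  stage_GF : G F;
  stage_SUm : SU \is monic;
  stage_SUs : size SU = d.+1;
  stage_br1 : forall g, G g ->
    (size (q * br g (E SU) - (z * g * F) *+ (dg g %/ e))%R
       <= (dg g + dg F).+1)%N;
  stage_br2 : forall g h, G g -> G h ->
    (size (q * E SU * br g h)%R <= (dg g + dg h + dg F).+1)%N
}.

(** * One stage: attained degrees and the lower bound for the key polynomial *)

Section Step.
Variables (G : B -> Prop) (e d : nat) (SF : nat -> {poly L}) (F : B).
Variable SU : {poly L}.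
Hypothesis st : stage G e d SF F SU.
Local Notation U := (E SU).
Local Notation n := (dg q).

Let e0 := stage_e st.
Let d0 := stage_d st.
Let GM := stage_GM st.
Let Gn0 := stage_Gn0 st.

Lemma stage_n0 : (0 < n)%N.
Proof. by rewrite (stage_q st) muln_gt0 d0 e0. Qed.

Lemma stage_GX g i : G g -> G (g ^+ i).
Proof.
move=> Gg; elim: i => [|i IH]; first by rewrite expr0; apply: stage_G1 st.
by rewrite exprS; apply: GM.
Qed.

(** Divided by e, the degrees of the d elements [E (SF l)] are distinct modulo d, so every residue
    occurs. The bound on [dg F] makes the required exponent of q nonnegative. *)
Lemma stage_deg_surj N : (e %| N)%N -> (dg F < N + n)%N ->
  exists i l, (l < d)%N /\ dg (q ^+ i * E (SF l)) = N.
Proof.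
move=> eN FN.
pose phi (l : 'I_d) : 'I_d := Ordinal (ltn_pmod (dg (E (SF l)) %/ e) d0).
have phi_inj : injective phi.
  move=> l l' /(congr1 val) /= h; apply: val_inj.
  apply: (stage_inj st (ltn_ord l) (ltn_ord l')).
  rewrite -(divnK (stage_dvd st (stage_SFG st (ltn_ord l)))).
  rewrite -(divnK (stage_dvd st (stage_SFG st (ltn_ord l')))).
  by rewrite (stage_q st) -!muln_modl h.
have [psi _ phiK] := injF_bij phi_inj.
pose l := psi (Ordinal (ltn_pmod (N %/ e) d0)).
have hl : dg (E (SF l)) = N %[mod n].
  have /(congr1 val) /= h := phiK (Ordinal (ltn_pmod (N %/ e) d0)).
  rewrite -(divnK (stage_dvd st (stage_SFG st (ltn_ord l)))) -(divnK eN).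
  by rewrite (stage_q st) -!muln_modl h.
have ln0 := Gn0 (stage_SFG st (ltn_ord l)).
have lF := stage_SFF st (ltn_ord l).
have n0 := stage_n0.
have le_lN : (dg (E (SF l)) <= N)%N.
  have := divn_eq (dg (E (SF l))) n; have := divn_eq N n; rewrite hl.
  set a := (_ %/ _)%N; set b := (_ %/ _)%N => hb ha.
  have : (b * n < a.+1 * n)%N by rewrite mulSn; lia.
  by rewrite ltn_pmul2r // ltnS -(leq_pmul2r n0); lia.
exists ((N - dg (E (SF l))) %/ n)%N, l; split => //.
have dv : (n %| N - dg (E (SF l)))%N by rewrite -eqn_mod_dvd // hl.
rewrite dgM ?dgX ?expf_neq0 ?(Gn0 (stage_Gq st)) // divnK //.
by rewrite subnK.
Qed.

Lemma natr_poly_T m (f : B) : f *+ m = (iota m%:R)%:P * f.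
Proof. by rewrite rmorph_nat polyC_natr mulr_natl. Qed.

Lemma iota_eq0 c : (iota c == 0) = (c == 0).
Proof. exact: fmorph_eq0. Qed.

Lemma size_mulrn_iota m (f : B) : m%:R != 0 :> k -> size (f *+ m) = size f.
Proof.
by move=> m0; rewrite natr_poly_T size_Cmul // iota_eq0.
Qed.

(* Some g in G has dg g / e invertible in k: q if the characteristic does not
   divide d, otherwise any g with dg g / e = 1 modulo d. *)
Lemma stage_bound : U != 0 /\ (dg F + 2 <= n + dg U)%N.
Proof.
have [g Gg g0] : exists2 g, G g & (dg g %/ e)%:R != 0 :> k.
  case: (eqVneq (d%:R : k) 0) => [dk|dk]; last first.
    by exists q; [exact: stage_Gq st | rewrite (stage_q st) mulnK].
  (* The summand [n * dg F] lifts the degree into the attained range. Divided by e it is a multiple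
     of d, hence zero in k, so [dg g %/ e] becomes 1 in k. *)
  have [||i [l [ld h]]] := @stage_deg_surj (e + n * dg F)%N.
  - by rewrite dvdn_addr // (stage_q st) mulnAC dvdn_mull.
  - have := stage_n0; nia.
  - exists (q ^+ i * E (SF l)).
      by apply: GM; [apply: stage_GX (stage_Gq st) | exact: (stage_SFG st ld)].
    rewrite h (stage_q st) mulnAC divnDr ?dvdn_mull // divnn e0 mulnK //.
    by rewrite natrD natrM dk mul0r addr0 oner_neq0.
have gF0 : g * F != 0 by rewrite mulf_neq0 ?(Gn0 Gg) ?(Gn0 (stage_GF st)).
have sz : size (z * g * F *+ (dg g %/ e))%R = (dg g + dg F).+2.
  rewrite size_mulrn_iota // -mulrA mulrC size_mulX // -dgM ?(Gn0 (stage_GF st)) //.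
    by rewrite -size_dg.
  exact: Gn0.
(* The error allowed by [stage_br1] is too small to cancel the leading term of [b]. *)
have szq : (dg g + dg F + 2 <= size (q * br g U)%R)%N.
  rewrite addn2 -sz; set a := _ * br _ _; set b := _ *+ _.
  have -> : size b = size (b - a + a) by rewrite subrK.
  apply: leq_trans (size_polyD _ _) _; rewrite geq_max leqnn andbT.
  rewrite leqNgt; apply/negP => lt_a.
  have := stage_br1 st Gg; rewrite -/a -/b -opprB size_polyN.
  have : size (b - a + a) = size (b - a) by rewrite size_polyDl.
  by rewrite subrK sz => <-; rewrite ltnn.
have U0 : U != 0.
  apply: contraTneq szq => ->.
  by rewrite br0r mulr0 size_poly0; lia.
split => //; have := size_br D g U.
have q0 := size_dg (Gn0 (stage_Gq st)) => hb.
have : (size (q * br g U)%R <= n + (dg g + dg U))%N.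
  by rewrite mulrC addnC; apply: size_prod_le => //; rewrite q0.
lia.
Qed.

Local Notation e' := (gcdn e (dg U)).
Local Notation a := (e %/ gcdn e (dg U))%N.

Definition next_G (g : B) := exists h j, G h /\ g = h * U ^+ j.
(** Since [SU] has degree d in p, writing l in base d gives a product of degree exactly l. *)
Definition next_SF l := SF (l %% d)%N * SU ^+ (l %/ d)%N.

Let U0 : U != 0 := (stage_bound).1.

Lemma step_e0 : (0 < e')%N.
Proof. by rewrite gcdn_gt0 e0. Qed.

Lemma step_ea : e = (a * e')%N.
Proof. by rewrite divnK ?dvdn_gcdl. Qed.

Lemma step_a0 : (0 < a)%N.
Proof. by move: e0; rewrite {1}step_ea muln_gt0 => /andP[]. Qed.

Lemma step_Ua : (a * dg U)%N = (e * (dg U %/ e'))%N.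
Proof.
rewrite {3}step_ea -mulnA [(e' * _)%N]mulnC divnK ?dvdn_gcdr //.
Qed.

Lemma step_dvd j : (e %| j * dg U)%N -> (a %| j)%N.
Proof.
move=> h; have e'0 := step_e0.
have : (a * e' %| j * (dg U %/ e') * e')%N.
  by rewrite -step_ea -mulnA divnK ?dvdn_gcdr.
rewrite dvdn_pmul2r // Gauss_dvdl // /coprime.
rewrite -(eqn_pmul2r e'0) muln_gcdl !divnK ?dvdn_gcdl ?dvdn_gcdr ?mul1n //.
Qed.

(** Members of G have degree 0 modulo e, and [dg U] has order a modulo e. *)
Lemma step_modn g h j j' : G g -> G h ->
  (dg g + j * dg U = dg h + j' * dg U)%N -> j = j' %[mod a].
Proof.
move=> Gg Gh; have [r hr] := dvdnP (stage_dvd st Gg).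
have [s hs] := dvdnP (stage_dvd st Gh).
rewrite hr hs => H; wlog le_jj : g h j j' Gg Gh r s hr hs H / (j' <= j)%N.
  move=> W; case: (leqP j' j) => [l|/ltnW l]; first exact: (W g h j j' Gg Gh r s).
  by symmetry; apply: (W h g j' j Gh Gg s r).
apply/eqP; rewrite eqn_mod_dvd //; apply: step_dvd.
have -> : ((j - j') * dg U = (s - r) * e)%N by rewrite !mulnBl; lia.
exact: dvdn_mull.
Qed.

Lemma next_monic l : next_SF l \is monic.
Proof.
by rewrite monicMl ?monic_exp ?(stage_SUm st) // (stage_SFm st) // ltn_pmod.
Qed.


Lemma size_SUX j : size (SU ^+ j) = (j * d).+1.
Proof.
elim: j => [|j IH]; first by rewrite expr0 size_poly1 mul0n.
rewrite exprSr size_Mmonic ?(stage_SUm st) ?monic_neq0 ?monic_exp ?(stage_SUm st) //.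
by rewrite IH (stage_SUs st) mulSn; lia.
Qed.

Lemma next_size l : size (next_SF l) = l.+1.
Proof.
have ld := ltn_pmod l d0.
rewrite size_Mmonic ?monic_exp ?(stage_SUm st) ?monic_neq0 ?(stage_SFm st) //.
by rewrite (stage_SFs st ld) size_SUX {3}(divn_eq l d); lia.
Qed.

Lemma E_next_SF l : E (next_SF l) = E (SF (l %% d)%N) * U ^+ (l %/ d)%N.
Proof. by rewrite rmorphM rmorphXn. Qed.

Lemma next_GSF l : next_G (E (next_SF l)).
Proof.
exists (E (SF (l %% d)%N)), (l %/ d)%N; split; last exact: E_next_SF.
by apply: (stage_SFG st); apply: ltn_pmod.
Qed.

Lemma dg_next_SF l :
  dg (E (next_SF l)) = (dg (E (SF (l %% d)%N)) + (l %/ d) * dg U)%N.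
Proof.
rewrite E_next_SF dgM ?dgX ?expf_neq0 //; apply: Gn0; apply: (stage_SFG st).
exact: ltn_pmod.
Qed.

Lemma next_inj l l' : (l < d * a)%N -> (l' < d * a)%N ->
  dg (E (next_SF l)) = dg (E (next_SF l')) %[mod dg q] -> l = l'.
Proof.
move=> hl hl'; rewrite !dg_next_SF => H.
have [hm hm'] := (ltn_pmod l d0, ltn_pmod l' d0).
have Gl := stage_SFG st hm; have Gl' := stage_SFG st hm'.
have hj : (l %/ d = l' %/ d)%N.
  have hd m : (m < d * a)%N -> (m %/ d < a)%N by move=> ?; rewrite ltn_divLR // mulnC.
  rewrite -(modn_small (hd _ hl)) -(modn_small (hd _ hl')).
  set x := (dg (E (SF (l %% d)))) in H *; set y := (dg (E (SF (l' %% d)))) in H *.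
  (* Exchanging the two quotients by n turns the congruence into an equality, realized in G by
     powers of q. *)
  have [u [v huv]] : exists u v, (u * n + (x + (l %/ d) * dg U) = v * n + (y + (l' %/ d) * dg U))%N.
    exists ((y + (l' %/ d) * dg U) %/ n)%N, ((x + (l %/ d) * dg U) %/ n)%N.
    have := divn_eq (x + (l %/ d) * dg U) n; rewrite H.
    have := divn_eq (y + (l' %/ d) * dg U) n.
    set A := ((y + _) %/ n)%N; set C := ((x + _) %/ n)%N => hy hx.
    by rewrite [(x + _)%N]hx [in RHS]hy addnCA.
  apply: (@step_modn (q ^+ u * E (SF (l %% d)%N)) (q ^+ v * E (SF (l' %% d)%N))).
  - by apply: GM => //; apply: stage_GX (stage_Gq st).
  - by apply: GM => //; apply: stage_GX (stage_Gq st).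
  - by rewrite !dgM ?dgX ?expf_neq0 ?(Gn0 (stage_Gq st)) ?(Gn0 Gl) ?(Gn0 Gl') // -!addnA.
rewrite (divn_eq l d) (divn_eq l' d) hj; congr addn.
apply: (stage_inj st) => //; move/eqP: H; rewrite hj eqn_modDr => /eqP; done.
Qed.

(** The degree [a * dg U] is a multiple of e, and [stage_bound] puts it in the range of
    [stage_deg_surj]. The element found is the one against which [U ^+ a] is compared. *)
Lemma step_M : exists SM : {poly L}, [/\ (size SM <= d)%N, G (E SM) & dg (E SM) = (a * dg U)%N].
Proof.
have [||i [l [ld h]]] := @stage_deg_surj (a * dg U)%N.
- by rewrite step_Ua dvdn_mulr.
- have [_ b] := stage_bound; have := step_a0; nia.
exists (qL%:P ^+ i * SF l); split; last by rewrite rmorphM rmorphXn.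
- rewrite -rmorphXn /= mul_polyC; apply: leq_trans (size_scale_leq _ _) _.
  by rewrite (stage_SFs st ld).
- rewrite rmorphM rmorphXn; apply: GM; first exact: stage_GX (stage_Gq st).
  exact: (stage_SFG st ld).
Qed.

Lemma next_G0 g : next_G g -> g != 0.
Proof. by case=> h [j [Gh ->]]; rewrite mulf_neq0 ?expf_neq0 ?(Gn0 Gh). Qed.

Lemma next_GM g h : next_G g -> next_G h -> next_G (g * h).
Proof.
move=> [g1 [i [G1 ->]]] [h1 [j [H1 ->]]]; exists (g1 * h1), (i + j)%N.
by split; [exact: GM | rewrite exprD mulrACA].
Qed.

Lemma next_Gsub g : G g -> next_G g.
Proof. by move=> Gg; exists g, 0%N; rewrite expr0 mulr1. Qed.

Lemma next_GU : next_G U.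
Proof. by exists 1, 1%N; rewrite expr1 mul1r; split => //; apply: stage_G1 st. Qed.

Lemma next_dvd g : next_G g -> (e' %| dg g)%N.
Proof.
move=> [h [j [Gh ->]]]; rewrite dgM ?dgX ?expf_neq0 ?(Gn0 Gh) //.
rewrite dvdn_add ?dvdn_mull ?dvdn_gcdr //.
exact: dvdn_trans (dvdn_gcdl _ _) (stage_dvd st Gh).
Qed.

Lemma next_ind (P : B -> Prop) :
  (forall g, G g -> P g) -> P U ->
  (forall g h, next_G g -> next_G h -> P g -> P h -> P (g * h)) ->
  forall g, next_G g -> P g.
Proof.
move=> PG PU PM g [h [j [Gh ->]]].
elim: j => [|j IH]; first by rewrite expr0 mulr1; apply: PG.
rewrite exprSr mulrA; apply: PM => //; last exact: next_GU.
by exists h, j.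
Qed.

(** * The next stage when the leading coefficients are proportional *)

Section Dependent.
Variables (SM : {poly L}) (c : k).
Hypotheses (SMs : (size SM <= d)%N) (GSM : G (E SM)).
Hypothesis dgSM : dg (E SM) = (a * dg U)%N.
Hypotheses (c0 : c != 0) (lcM : lead_coef U ^+ a = iota c * lead_coef (E SM)).
Local Notation M := (E SM).

(** The constant c cancels the leading terms of [U ^+ a] and M under E, while the degree in p stays
    that of [SU ^+ a]. *)
Definition next_SU := SU ^+ a - (cL c)%:P * SM.
(** Indices below [d * a] involve at most the power a - 1 of U, so this dominates all the new
    representatives. *)
Definition next_F := F * U ^+ a.-1.
Local Notation U' := (E next_SU).
Local Notation F' := next_F.

Lemma E_next_SU : U' = U ^+ a - (iota c)%:P * M.
Proof. by rewrite rmorphB rmorphM rmorphXn EcL. Qed.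

Lemma size_next_U : (size U' <= a * dg U)%N.
Proof.
rewrite E_next_SU -dgX; apply: size_sub_lead.
  by rewrite dgX -dgSM mul_polyC size_scale ?iota_eq0.
by rewrite lead_coef_exp lcM lead_coefM lead_coefC.
Qed.

Lemma dg_next_F : dg F' = (dg F + a.-1 * dg U)%N.
Proof. by rewrite dgM ?dgX ?expf_neq0 ?(Gn0 (stage_GF st)). Qed.

Lemma next_SU_monic : next_SU \is monic.
Proof.
apply/monicP; rewrite /next_SU lead_coefDl.
  by apply/monicP; rewrite monic_exp ?(stage_SUm st).
rewrite size_polyN size_SUX mul_polyC ltnS.
apply: leq_trans (size_scale_leq _ _) _; apply: leq_trans SMs _.
by rewrite leq_pmull // step_a0.
Qed.

Lemma next_SU_size : size next_SU = (d * a).+1.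
Proof.
rewrite /next_SU size_polyDl size_SUX; first by rewrite mulnC.
rewrite size_polyN mul_polyC ltnS.
apply: leq_trans (size_scale_leq _ _) _; apply: leq_trans SMs _.
by rewrite leq_pmull // step_a0.
Qed.

(** By [step_modn] the exponents of U differ by a multiple of a. Each surplus [U ^+ a] has, up to c,
    the degree and leading coefficient of M, so [stage_lc] applies inside G. *)
Lemma next_lc g h : next_G g -> next_G h -> dg g = dg h ->
  exists2 x, x != 0 & lead_coef g = iota x * lead_coef h.
Proof.
move=> [g1 [i [G1 ->]]] [h1 [j [H1 ->]]].
have [g10 h10] := (Gn0 G1, Gn0 H1).
rewrite !dgM ?expf_neq0 // !dgX => H.
wlog le_ij : g1 h1 i j G1 H1 g10 h10 H / (i <= j)%N.
  move=> W; case: (leqP i j) => [l|/ltnW l]; first exact: W.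
  have [x x0 hx] := W h1 g1 j i H1 G1 h10 g10 (esym H) l.
  exists x^-1; first by rewrite invr_eq0.
  by rewrite hx mulrA -rmorphM mulVf // rmorph1 mul1r.
have /dvdnP [r hr] : (a %| j - i)%N.
  by rewrite -eqn_mod_dvd //; apply/eqP; rewrite (step_modn G1 H1 H).
have Gr : G (h1 * M ^+ r) by apply: GM => //; apply: stage_GX.
have [|x x0 hx] := stage_lc st G1 Gr.
  rewrite dgM ?expf_neq0 ?(Gn0 GSM) // dgX dgSM mulnA -hr mulnBl.
  have : (i * dg U <= j * dg U)%N by rewrite leq_mul2r le_ij orbT.
  lia.
exists (x * c ^- r); first by rewrite mulf_neq0 ?invr_eq0 ?expf_neq0.
rewrite !lead_coefM hx !lead_coefM !lead_coef_exp rmorphM.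
have -> : j = (r * a + i)%N by rewrite -hr subnK.
rewrite exprD mulnC exprM lcM exprMn.
have : iota (c ^- r) * iota c ^+ r = 1.
  by rewrite -rmorphXn -rmorphM mulVf ?rmorph1 ?expf_neq0.
move: (iota c ^+ r) (iota (c ^- r)) (lead_coef M ^+ r) (lead_coef U ^+ i) => A A' B C hA.
apply/esym; transitivity ((iota x * (lead_coef h1 * B) * C) * (A' * A)); first by ring.
by rewrite hA mulr1.
Qed.

Definition next_err g := q * br g U' - (z * g * F') *+ (dg g %/ e').

(** Both the bracket with U' and the term weighted by the additive degree obey the Leibniz rule; so
    the estimates need checking only on G and on U. *)
Lemma next_errM g h : next_G g -> next_G h ->
  next_err (g * h) = g * next_err h + h * next_err g.
Proof.
move=> Gg Gh; rewrite /next_err dgM ?next_G0 // divnDl ?next_dvd // (brMl DM).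
by rewrite mulrnDr; ring.
Qed.

Lemma dg_div_e g : G g -> (dg g %/ e' = dg g %/ e * a)%N.
Proof.
move=> Gg; have /dvdnP [r ->] := stage_dvd st Gg.
by rewrite mulnK // {1}step_ea mulnA mulnK // step_e0.
Qed.

Lemma size_qbrU g : G g -> (size (q * br g U)%R <= (dg g + dg F).+2)%N.
Proof.
move=> Gg; have h := stage_br1 st Gg.
rewrite -(subrK (z * g * F *+ (dg g %/ e)) (q * br g U)).
apply: size_sum_le; first by apply: leq_trans h _; lia.
apply: size_mulrn_le; rewrite -mulrA mulrC size_mulX ?mulf_neq0 ?(Gn0 Gg) ?(Gn0 (stage_GF st)) //.
by rewrite ltnS -dgM ?(Gn0 Gg) ?(Gn0 (stage_GF st)) // leqSpred.
Qed.

(** This is [stage_br2] with the factor U cancelled, which presupposes a nonzero bracket. *)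
Lemma size_qbr g h : G g -> G h -> br g h = 0 \/
  (size (q * br g h)%R + dg U <= (dg g + dg h + dg F).+1)%N.
Proof.
move=> Gg Gh; case: (eqVneq (br g h) 0) => [|b0]; [by left | right].
have := stage_br2 st Gg Gh; rewrite mulrAC.
have qb0 : q * br g h != 0 by rewrite mulf_neq0 ?(Gn0 (stage_Gq st)).
by rewrite size_mul // (size_dg U0) addnS.
Qed.

Lemma next_br1 g : next_G g -> (size (next_err g) <= (dg g + dg F').+1)%N.
Proof.
move: g; apply: next_ind => [g Gg||g h Gg Gh hg hh].
(* For g in G, {g, U^a} contributes the factor a = e / e' by which the weight of g changes; {g, M}
   is of lower order by [size_qbr]. *)
- rewrite /next_err dg_div_e // E_next_SU brDr brNr (brMr DM) br_cstr // mulr0 addr0.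
  rewrite -(prednK step_a0) (brXr DM) prednK ?step_a0 //.
  have -> : q * (U ^+ a.-1 * br g U *+ a - (iota c)%:P * br g M) - z * g * F' *+ (dg g %/ e * a)
     = ((q * br g U - z * g * F *+ (dg g %/ e)) * U ^+ a.-1) *+ a - (iota c)%:P * (q * br g M).
    by rewrite /next_F mulrnA; ring.
  rewrite dg_next_F; apply: size_sub_le.
    apply: size_mulrn_le; rewrite addnA -addSn; apply: size_prod_le.
      exact: (stage_br1 st Gg).
    by rewrite -dgX leqSpred.
  rewrite mul_polyC; apply: leq_trans (size_scale_leq _ _) _.
  have [->|] := size_qbr Gg GSM; first by rewrite mulr0 size_poly0.
  rewrite dgSM; have := step_a0; case: (a) => // a1 _ /=; lia.
(* For g = U only c {M, U} remains. Its main part contains c M, which is U^a up to U', of lower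
   degree. *)
- rewrite /next_err E_next_SU brDr brNr (brMr DM) br_cstr // mulr0 addr0.
  have -> : br U (U ^+ a) = 0.
    by rewrite -(prednK step_a0) (brXr DM) brff mulr0 mul0rn.
  have hd : (dg M %/ e = dg U %/ e')%N by rewrite dgSM step_Ua mulKn.
  rewrite (brC D U M) sub0r !mulrN opprK.
  have -> : q * ((iota c)%:P * br M U) - z * U * F' *+ (dg U %/ e')
    = (iota c)%:P * (q * br M U - z * M * F *+ (dg M %/ e)) - (z * F * U') *+ (dg M %/ e).
    have hUa : U ^+ a = U * U ^+ a.-1 by rewrite -exprS prednK ?step_a0.
    by rewrite hd E_next_SU /next_F hUa; ring.
  rewrite dg_next_F; apply: size_sub_le.
    rewrite mul_polyC; apply: leq_trans (size_scale_leq _ _) _.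
    apply: leq_trans (stage_br1 st GSM) _; rewrite dgSM.
    have := step_a0; case: (a) => // a1 _ /=; lia.
  apply: size_mulrn_le; rewrite mulrC.
  have -> : ((dg U + (dg F + a.-1 * dg U)).+1 = a * dg U + (dg F).+1)%N.
    have := step_a0; case: (a) => // a1 _ /=; lia.
  apply: size_prod_le; first exact: size_next_U.
  rewrite mulrC size_mulX ?(Gn0 (stage_GF st)) // ltnS.
  by apply: leqSpred.
- rewrite next_errM // dgM ?next_G0 //; apply: size_sum_le.
    rewrite mulrC; have -> : (dg g + dg h + dg F').+1 = ((dg h + dg F').+1 + dg g)%N by lia.
    by apply: size_prod_le => //; apply: leqSpred.
  rewrite mulrC; have -> : (dg g + dg h + dg F').+1 = ((dg g + dg F').+1 + dg h)%N by lia.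
  by apply: size_prod_le => //; apply: leqSpred.
Qed.

(** The Leibniz rule reduces this to pairs of generators. On G and G the degree of U' is offset by
    [size_qbr], on G and U by [size_qbrU], and {U, U} = 0. *)
Lemma next_br2 g h : next_G g -> next_G h ->
  (size (q * U' * br g h)%R <= (dg g + dg h + dg F').+1)%N.
Proof.
pose P g h := (size (q * U' * br g h)%R <= (dg g + dg h + dg F').+1)%N.
have PC g1 h1 : P g1 h1 -> P h1 g1.
  by rewrite /P brC mulrN size_polyN [(dg g1 + _)%N]addnC.
have PM g1 h1 h2 : next_G h1 -> next_G h2 -> P g1 h1 -> P g1 h2 -> P g1 (h1 * h2).
  rewrite /P => n1 n2 p1 p2; rewrite (brMr DM) dgM ?next_G0 //.
  have -> : q * U' * (h1 * br g1 h2 + h2 * br g1 h1)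
      = (q * U' * br g1 h2) * h1 + (q * U' * br g1 h1) * h2 by ring.
  apply: size_sum_le.
    have -> : (dg g1 + (dg h1 + dg h2) + dg F').+1 = ((dg g1 + dg h2 + dg F').+1 + dg h1)%N by lia.
    by apply: size_prod_le => //; apply: leqSpred.
  have -> : (dg g1 + (dg h1 + dg h2) + dg F').+1 = ((dg g1 + dg h1 + dg F').+1 + dg h2)%N by lia.
  by apply: size_prod_le => //; apply: leqSpred.
have PGG g1 h1 : G g1 -> G h1 -> P g1 h1.
  move=> G1 H1; rewrite /P mulrAC mulrC.
  have [->|hs] := size_qbr G1 H1; first by rewrite !mulr0 size_poly0.
  apply: leq_trans (size_prod_le size_next_U (leqSpred _)) _.
  rewrite dg_next_F; move: hs; have := step_a0; case: (a) => // a1 _ /=.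
  by move: (size (q * _)); lia.
have PGU g1 : G g1 -> P g1 U.
  move=> G1; rewrite /P mulrAC mulrC dg_next_F.
  apply: leq_trans (size_prod_le size_next_U (size_qbrU G1)) _.
  have := step_a0; case: (a) => // a1 _ /=; lia.
move=> Gg Gh; apply: (next_ind (P := P g)) Gh => [h1 H1||h1 h2 N1 N2]; last exact: PM.
  apply: (PC _ _); apply: (next_ind (P := P h1)) Gg => [g1 G1||g1 g2 N1 N2]; last exact: PM.
    exact: PGG.
  exact: PGU.
apply: (PC _ _); apply: (next_ind (P := P U)) Gg => [g1 G1||g1 g2 N1 N2]; last exact: PM.
  by apply: (PC _ _); apply: PGU.
by rewrite /P brff mulr0 size_poly0.
Qed.

Lemma next_stage : stage next_G e' (d * a) next_SF F' next_SU.
Proof.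
split.
- exact: next_Gsub (stage_G1 st).
- exact: next_Gsub (stage_Gq st).
- exact: next_GM.
- exact: next_G0.
- exact: step_e0.
- by rewrite muln_gt0 d0 step_a0.
- by rewrite (stage_q st) {1}step_ea mulnA.
- exact: next_dvd.
- exact: next_lc.
- by move=> l _; apply: next_monic.
- by move=> l _; apply: next_size.
- by move=> l _; apply: next_GSF.
- move=> l hl; rewrite dg_next_SF dg_next_F leq_add //.
    by apply: (stage_SFF st); apply: ltn_pmod.
  rewrite leq_mul2r -ltnS prednK ?step_a0 // ltn_divLR // mulnC hl orbT //.
- exact: next_inj.
- exists F, a.-1; split => //; exact: stage_GF st.
- exact: next_SU_monic.
- exact: next_SU_size.
- exact: next_br1.
- exact: next_br2.
Qed.

End Dependent.

(** * Leading terms of expansions in powers of a key polynomial *)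

Section Expansion.
Hypothesis lc_L : forall g : L, E g%:P = 0 \/ exists i x,
  [/\ x != 0, E g%:P != 0, dg (E g%:P) = (i * n)%N
    & lead_coef (E g%:P) = iota x * lead_coef q ^+ i].
Local Notation d' := (d * a)%N.

(** Coefficients from L have degrees divisible by n, and the [next_SF l] have distinct degrees
    modulo n; so nonzero summands have distinct degrees and one of them leads. *)
Lemma next_span N (S : {poly L}) : (N <= d')%N -> (size S <= N)%N -> E S = 0 \/
  exists i l x, [/\ (l < N)%N, x != 0, E S != 0,
    dg (E S) = dg (q ^+ i * E (next_SF l))
    & lead_coef (E S) = iota x * lead_coef (q ^+ i * E (next_SF l))].
Proof.
elim: N S => [|N IH] S Nd sS.
  by left; have /eqP -> : S == 0; rewrite -?size_poly_leq0 ?rmorph0.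
pose s := S`_N; pose S1 := S - s%:P * next_SF N.
have sS1 : (size S1 <= N)%N.
  apply/leq_sizeP => j; rewrite leq_eqVlt coefB coefCM => /orP[/eqP <-|hj].
    have /monicP := next_monic N; rewrite lead_coefE next_size /= => ->.
    by rewrite mulr1 subrr.
  by rewrite !nth_default ?mulr0 ?subr0 // ?next_size //; apply: leq_trans sS hj.
have -> : S = S1 + s%:P * next_SF N by rewrite subrK.
have EN0 : E (next_SF N) != 0 by apply: next_G0 (next_GSF N).
have q0 := Gn0 (stage_Gq st).
rewrite rmorphD rmorphM.
have [->|[i1 [l1 [x1 [hl1 x10 E10 dg1 lc1]]]]] := IH S1 (ltnW Nd) sS1.
  rewrite add0r; have [->|[i [x [x0 Es0 dgs lcs]]]] := lc_L s.
    by left; rewrite mul0r.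
  right; exists i, N, x; rewrite ltnSn mulf_neq0 // !dgM ?expf_neq0 // dgs dgX.
  by rewrite !lead_coefM lcs lead_coef_exp mulrA.
have [->|[i [x [x0 Es0 dgs lcs]]]] := lc_L s.
  rewrite mul0r addr0; right; exists i1, l1, x1; split => //.
  exact: ltn_trans hl1 (ltnSn N).
right; have dgn : dg (E S1) != dg (E s%:P * E (next_SF N)).
  rewrite dg1 !dgM ?expf_neq0 ?(next_G0 (next_GSF l1)) // dgs dgX.
  apply/eqP => h; suff e1 : l1 = N by move: hl1; rewrite e1 ltnn.
  apply: next_inj => //; first exact: ltn_trans hl1 Nd.
  by rewrite -(modnMDl i1) h modnMDl.
have P0 : E s%:P * E (next_SF N) != 0 by rewrite mulf_neq0.
have [lt_dg|lt_dg|e_dg] := ltngtP (dg (E S1)) (dg (E s%:P * E (next_SF N))).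
- have sz : (size (E S1) < size (E s%:P * E (next_SF N))%R)%N.
    by rewrite (size_dg P0) (size_dg E10).
  exists i, N, x; rewrite ltnSn -size_poly_gt0 addrC size_polyDl // lead_coefDl //.
  rewrite size_poly_gt0 P0 !dgM ?expf_neq0 // dgs dgX; split => //.
  by rewrite !lead_coefM lcs lead_coef_exp mulrA.
- have sz : (size (E s%:P * E (next_SF N))%R < size (E S1))%N.
    by rewrite (size_dg P0) (size_dg E10).
  exists i1, l1, x1; rewrite -size_poly_gt0 size_polyDl // lead_coefDl //.
  by rewrite size_poly_gt0 E10 -dg1 ; split => //; apply: ltn_trans hl1 (ltnSn N).
- by rewrite e_dg eqxx in dgn.
Qed.

Lemma next_expand (S : {poly L}) : exists J (Q : nat -> {poly L}),
  S = \sum_(r < J.+1) Q r * (SU ^+ a) ^+ r /\ forall r, (size (Q r) <= d')%N.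
Proof.
have monV : SU ^+ a \is monic by rewrite monic_exp ?(stage_SUm st).
have sV : size (SU ^+ a) = d'.+1 by rewrite size_SUX mulnC.
have d'0 : (0 < d')%N by rewrite muln_gt0 d0 step_a0.
have [m] := ubnP (size S); elim: m S => // m IH S; rewrite ltnS => hS.
case: (leqP (size S) d') => [le|lt].
  exists 0%N, (fun r => if r == 0%N then S else 0); rewrite big_ord1 mulr1; split => // r.
  by case: eqP => // _; rewrite size_poly0.
have eqS := Pdiv.RingMonic.rdivp_eq monV S.
have V0 := monic_neq0 monV.
have ltm := Pdiv.Ring.ltn_rmodpN0 S V0.
have [|J [Q [hQ sQ]]] := IH (Pdiv.Ring.rdivp S (SU ^+ a)).
  have := Pdiv.Ring.leq_rdivp S (SU ^+ a).
  case: (eqVneq (Pdiv.Ring.rdivp S (SU ^+ a)) 0) => [->|r0]; first by rewrite size_poly0; lia.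
  have szP : size (Pdiv.Ring.rdivp S (SU ^+ a) * SU ^+ a) = (size (Pdiv.Ring.rdivp S (SU ^+ a)) + d')%N.
    by rewrite size_Mmonic // sV addnS.
  have r1 : (0 < size (Pdiv.Ring.rdivp S (SU ^+ a)))%N by rewrite size_poly_gt0.
  move: hS; rewrite {1}eqS size_polyDl szP; last by rewrite -addn1 addnC leq_add // -ltnS -sV.
  by move: r1; move: (size (Pdiv.Ring.rdivp _ _)) => y; lia.
exists J.+1, (fun r => if r is r'.+1 then Q r' else Pdiv.Ring.rmodp S (SU ^+ a)).
split; last by case => [|r] //; rewrite -ltnS -sV.
rewrite big_ord_recl /= mulr1 {1}eqS {1}hQ addrC mulr_suml; congr (_ + _).
by apply: eq_bigr => r _; rewrite exprSr mulrA.
Qed.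

Section Independent.
Variables (SM : {poly L}).
Hypotheses (GSM : G (E SM)) (dgSM : dg (E SM) = (a * dg U)%N).
Local Notation M := (E SM).
Hypothesis indep : forall R (x : 'I_R.+1 -> k),
  \sum_(i < R.+1) iota (x i) * (lead_coef U ^+ a) ^+ i * lead_coef M ^+ (R - i) = 0 ->
  forall i, x i = 0.

(* The leading coefficients of the summands of maximal degree are
   C (A / B) ^ r up to scalars, with A and B those of U ^ a and M. *)
Lemma no_cancellation (S : {poly L}) : exists J (Q : nat -> {poly L}),
  [/\ S = \sum_(r < J.+1) Q r * (SU ^+ a) ^+ r, forall r, (size (Q r) <= d')%N
    & forall r, (r < J.+1)%N -> E (Q r) != 0 ->
        (dg (E (Q r)) + r * (a * dg U) <= dg (E S))%N].
Proof.
have [J [Q [hS sQ]]] := next_expand S; exists J, Q; split => //.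
pose w r := E (Q r) * (U ^+ a) ^+ r.
have Ua0 : U ^+ a != 0 by rewrite expf_neq0.
have ES : E S = \sum_(r < J.+1) w r.
  by rewrite hS rmorph_sum; apply: eq_bigr => r _; rewrite rmorphM !rmorphXn.
have dgw r : E (Q r) != 0 -> dg (w r) = (dg (E (Q r)) + r * (a * dg U))%N.
  by move=> h; rewrite dgM ?expf_neq0 // !dgX.
pose N := (\max_(r < J.+1) dg (w r))%N.
suff hN : (N <= dg (E S))%N.
  move=> r hr Q0; rewrite -dgw //; apply: leq_trans hN.
  exact: (leq_bigmax (Ordinal hr)).
rewrite leqNgt; apply/negP => ltN.
have [r0 hr0] : exists r0 : 'I_J.+1, N = dg (w r0).
  have cJ : (0 < #|'I_J.+1|)%N by rewrite card_ord.
  by have [r0 hr0] := eq_bigmax (fun r : 'I_J.+1 => dg (w r)) cJ; exists r0.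
have Q0 : E (Q r0) != 0.
  apply/eqP => h; move: ltN; rewrite hr0 /w h mul0r size_poly0.
  by rewrite ltn0.
(* Replacing [(U ^+ a) ^+ r] with [M ^+ r], of equal degree, leaves a member of G times [U ^+ j]
   with j < a. Equal degrees force equal j, so [stage_lc] compares the members of G. *)
have tops r r' : E (Q r) != 0 -> E (Q r') != 0 -> dg (w r) = N -> dg (w r') = N ->
    exists2 y, y != 0 & lead_coef (E (Q r)) * lead_coef M ^+ r
      = iota y * (lead_coef (E (Q r')) * lead_coef M ^+ r').
  have parts s : E (Q s) != 0 -> dg (w s) = N -> exists g j x,
      [/\ G g, (j < a)%N, x != 0, (dg g + j * dg U)%N = N
        & lead_coef (E (Q s)) * lead_coef M ^+ s = iota x * (lead_coef g * lead_coef U ^+ j)].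
    move=> Qs0 dgs; have [h|[i [l [x [hl x0 _ dgQ lcQ]]]]] := next_span (leqnn _) (sQ s).
      by rewrite h eqxx in Qs0.
    have Gf := stage_SFG st (ltn_pmod l d0).
    have Gqi : G (q ^+ i) by apply: stage_GX (stage_Gq st).
    have GMs : G (M ^+ s) by apply: stage_GX.
    exists (q ^+ i * E (SF (l %% d)%N) * M ^+ s), (l %/ d)%N, x; split => //.
    - by apply: GM => //; apply: GM.
    - by rewrite ltn_divLR // mulnC.
    - rewrite -dgs dgw // dgQ !dgM ?mulf_neq0 ?(Gn0 Gf) ?(Gn0 Gqi) ?(Gn0 GMs) ?(next_G0 (next_GSF l)) //.
      by rewrite dg_next_SF dgX [dg (M ^+ s)]dgX dgSM -!addnA; congr (_ + (_ + _))%N; apply: addnC.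
    - by rewrite lcQ E_next_SF !lead_coefM !lead_coef_exp; ring.
  move=> Qr Qr' dr dr'; have [g [j [x [Gg ja x0 dgg ->]]]] := parts r Qr dr.
  have [g' [j' [x' [Gg' ja' x0' dgg' ->]]]] := parts r' Qr' dr'.
  have ejj : j = j'.
    have := @step_modn g g' j j' Gg Gg'; rewrite dgg dgg' => /(_ erefl).
    by rewrite !modn_small.
  have [|y y0 ->] := stage_lc st Gg Gg'; first by move: dgg; rewrite ejj -dgg' => /addIn.
  exists (x * y / x'); first by rewrite !mulf_neq0 ?invr_eq0.
  rewrite ejj !mulrA -!rmorphM mulfVK //.
(* Summands below degree N get x = 0, so all coefficients at N enter one homogeneous relation of
   degree J. *)
have coefs (r : 'I_J.+1) : exists x : k,
    (w r)`_N * lead_coef M ^+ r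
      = iota x * (lead_coef U ^+ a) ^+ r * (lead_coef (E (Q r0)) * lead_coef M ^+ r0)
    /\ (x = 0 -> (w r)`_N = 0).
  case: (eqVneq (E (Q r)) 0) => [h|Qr0].
    by exists 0; rewrite /w h mul0r coef0 rmorph0 !mul0r.
  have := leq_bigmax (F := fun r : 'I_J.+1 => dg (w r)) r; rewrite -/N /= leq_eqVlt.
  case/orP => [/eqP hN|hN]; last first.
    exists 0; rewrite nth_default ?rmorph0 ?mul0r //.
    exact: leq_trans (leqSpred _) hN.
  have [x x0 hx] := tops r r0 Qr0 Q0 hN (esym hr0).
  exists x; rewrite -{1}hN -lead_coefE lead_coefM !lead_coef_exp; split.
    by rewrite mulrAC hx; ring.
  by move=> h; rewrite h eqxx in x0.
have [x hx] := fin_all_exists coefs.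
have C0 : lead_coef (E (Q r0)) * lead_coef M ^+ r0 != 0.
  by rewrite mulf_neq0 ?expf_neq0 ?lead_coef_eq0 ?(Gn0 GSM).
have sum0 : \sum_(r < J.+1) iota (x r) * (lead_coef U ^+ a) ^+ r * lead_coef M ^+ (J - r) = 0.
  apply: (mulIf C0); rewrite mul0r mulr_suml.
  transitivity ((E S)`_N * lead_coef M ^+ J); last first.
    by rewrite nth_default ?mul0r //; apply: leq_trans (leqSpred _) ltN.
  rewrite ES coef_sum mulr_suml; apply: eq_bigr => r _.
  have -> : lead_coef M ^+ J = lead_coef M ^+ r * lead_coef M ^+ (J - r).
    by rewrite -exprD subnKC // -ltnS.
  by rewrite mulrA (hx r).1; ring.
have := (hx r0).2 (indep sum0 r0); rewrite hr0 -lead_coefE => /eqP.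
by rewrite lead_coef_eq0 /w (negbTE (mulf_neq0 Q0 (expf_neq0 _ Ua0))).
Qed.

End Independent.
End Expansion.
End Step.
End KeyPolynomials.

(** * Termination of the chain and reduction of degrees *)

Section Chain.
Variables (T : idomainType) (D : {additive T -> T}).
Hypothesis DM : forall a b, D (a * b) = D a * b + a * D b.
Variables (k : fieldType) (iota : {rmorphism k -> T}).
Hypothesis Diota : forall c, D (iota c) = 0.
Variables (L : comNzRingType) (E : {rmorphism {poly L} -> {poly T}}).
Variables (qL : L) (cL : k -> L).
Hypothesis EcL : forall c, E (cL c)%:P = (iota c)%:P.
Local Notation q := (E qL%:P).
Hypothesis lc_L : forall g : L, E g%:P = 0 \/ exists i x,
  [/\ x != 0, E g%:P != 0, dg (E g%:P) = (i * dg q)%N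
    & lead_coef (E g%:P) = iota x * lead_coef q ^+ i].
Hypothesis iota_closed : forall A B : T, A != 0 -> B != 0 ->
  (exists2 c, c != 0 & A = iota c * B) \/
  forall R (x : 'I_R.+1 -> k),
    \sum_(i < R.+1) iota (x i) * A ^+ i * B ^+ (R - i) = 0 ->
    forall i, x i = 0.
Local Notation stage := (stage D iota E qL).

(** A nonzero summand with r > 0 would have degree at least [a * dg U], which exceeds 1. Only the
    digit [Q 0] remains, and [next_span] describes its leading term. *)
Lemma independent_deg1 G e d SF F SU SM S : stage G e d SF F SU ->
  G (E SM) -> dg (E SM) = (e %/ gcdn e (dg (E SU)) * dg (E SU))%N ->
  (forall R (x : 'I_R.+1 -> k),
    \sum_(i < R.+1) iota (x i) * (lead_coef (E SU) ^+ (e %/ gcdn e (dg (E SU)))) ^+ i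
      * lead_coef (E SM) ^+ (R - i) = 0 -> forall i, x i = 0) ->
  (1 < dg (E SU))%N -> dg (E S) = 1%N ->
  exists i l x, [/\ (l < d * (e %/ gcdn e (dg (E SU))))%N, x != 0,
    dg (q ^+ i * E (next_SF d SF SU l)) = 1%N
    & lead_coef (E S) = iota x * lead_coef (q ^+ i * E (next_SF d SF SU l))].
Proof.
move=> st GSM dgSM indep U1 dgS; have a0 := step_a0 st.
have [J [Q [eS sQ hQ]]] := no_cancellation st lc_L GSM dgSM indep S.
have ES : E S = E (Q 0%N).
  rewrite {1}eS big_ord_recl mulr1 rmorphD rmorph_sum big1 ?addr0 // => r _.
  rewrite rmorphM; case: (eqVneq (E (Q (lift ord0 r))) 0) => [->|Q0]; first by rewrite mul0r.
  have := hQ _ (ltn_ord (lift ord0 r)) Q0; rewrite dgS => h.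
  have : ((lift ord0 r) * (e %/ gcdn e (dg (E SU)) * dg (E SU)) <= 1)%N.
    exact: leq_trans (leq_addl _ _) h.
  rewrite leqNgt (leq_trans U1) // mulnA leq_pmull // muln_gt0 a0 andbT.
  by rewrite lift0.
have := next_span st lc_L (leqnn _) (sQ 0%N).
rewrite -ES => -[h|[i [l [x [hl x0 _ h1 h2]]]]]; last by exists i, l, x; rewrite -h1.
by move: dgS; rewrite h size_poly0.
Qed.

(** N bounds dg q + dg U - dg F, which [stage_bound] keeps at least 2 and which drops at each stage.
    The third hypothesis says dg q <= dg F'; with the bound for the next stage this gives 1 < dg
    U'. *)
Lemma chain_no_deg1 N G e d SF F SU S : stage G e d SF F SU ->
  (forall g, G g -> dg g != 1%N) -> (1 < dg (E SU))%N ->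
  (dg q <= dg F + (e %/ gcdn e (dg (E SU))).-1 * dg (E SU))%N ->
  (dg q + dg (E SU) <= dg F + N)%N -> dg (E S) != 1%N.
Proof.
elim: N G e d SF F SU => [|N IH] G e d SF F SU st Gne1 U1 hn hN.
  by have [_ bd] := stage_bound st; have := leq_trans bd hN; rewrite addn0 addn2 => /ltnW; rewrite ltnn.
have a0 := step_a0 st; have [U0 _] := stage_bound st.
have [SM [sSM GSM dgSM]] := step_M st.
have next_ne1 g : next_G E G SU g -> dg g != 1%N.
  move=> [h [j [Gh ->]]]; have := Gne1 h Gh.
  have aux x u i : x != 1%N -> (1 < u)%N -> (x + i * u)%N != 1%N.
    by case: i => [|i]; rewrite ?mulSn; lia.
  by move=> h1; rewrite dgM ?expf_neq0 ?(stage_Gn0 st Gh) // dgX; apply: aux.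
have [||[c c0 lcM]|indep] := @iota_closed (lead_coef (E SU) ^+ (e %/ gcdn e (dg (E SU)))) (lead_coef (E SM)).
- by rewrite expf_neq0 ?lead_coef_eq0.
- by rewrite lead_coef_eq0 (stage_Gn0 st).
- have Ugt0 : (0 < dg (E SU))%N by lia.
  have st' := next_stage DM Diota EcL st sSM GSM dgSM c0 lcM.
  have dgF' := dg_next_F st; have [_ bd] := stage_bound st'.
  have sU' := size_next_U EcL dgSM c0 lcM.
  apply: (IH _ _ _ _ _ _ st' next_ne1).
  + by rewrite -(leq_add2l (dg q)); apply: leq_trans bd; rewrite dgF' leq_add2r.
  + by rewrite dgF'; apply: leq_trans hn _; rewrite leq_addr.
  + have : (dg (E (next_SU E cL e SU SM c)) < (e %/ gcdn e (dg (E SU))) * dg (E SU))%N.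
      have : (0 < e %/ gcdn e (dg (E SU)) * dg (E SU))%N by rewrite muln_gt0 a0.
      by move: sU'; case: (size _) => // s; rewrite /= => ->.
    rewrite dgF' -{1}(prednK a0) mulSn; move: hN.
    move: (dg (E (next_SU _ _ _ _ _ _))) ((e %/ _).-1 * _)%N; lia.
- apply/eqP => dgS.
  have [i [l [x [_ _ h _]]]] := independent_deg1 st GSM dgSM indep U1 dgS.
  have nG : next_G E G SU (q ^+ i * E (next_SF d SF SU l)).
    apply: (next_GM st); last exact: (next_GSF st).
    by apply: next_Gsub; apply: (stage_GX st); apply: stage_Gq st.
  by have := next_ne1 _ nG; rewrite h.
Qed.

Section Core.
Local Notation p := (E 'X).
Hypothesis br_qp : br D q p = 'X.
Hypothesis q1 : (0 < dg q)%N.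
Variables (S1 S2 : {poly L}).
Hypotheses (dgS1 : dg (E S1) = 1%N) (dgS2 : dg (E S2) = 1%N).
Hypothesis lcS : forall c, lead_coef (E S2) != iota c * lead_coef (E S1).

Let q0 : q != 0.
Proof. by apply/eqP => h; move: q1; rewrite h size_poly0. Qed.

(** As {q, p} = z, one has q {q^i, p} = i z q^i, so the error in [stage_br1] is zero. *)
Lemma base_stage :
  stage (fun g => exists i, g = q ^+ i) (dg q) 1 (fun _ => 1) 1 'X.
Proof.
split => //.
- by exists 0%N.
- by exists 1%N.
- by move=> _ _ [i ->] [j ->]; exists (i + j)%N; rewrite exprD.
- by move=> _ [i ->]; rewrite expf_neq0.
- by rewrite mul1n.
- by move=> _ [i ->]; rewrite dgX dvdn_mull.
- move=> _ _ [i ->] [j ->]; rewrite !dgX => /eqP; rewrite eqn_pmul2r // => /eqP ->.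
  by exists 1; rewrite ?oner_neq0 // rmorph1 mul1r.
- by move=> l _; apply: monic1.
- by case=> // _; rewrite size_poly1.
- by move=> l _; exists 0%N; rewrite rmorph1.
- by move=> l _; rewrite rmorph1.
- by case=> // -[].
- by exists 0%N.
- exact: monicX.
- exact: size_polyX.
- move=> _ [[|i] ->].
    by rewrite expr0 (br1l DM) mulr0 size_poly1 div0n mulr0n subr0 size_poly0.
  rewrite (brXl DM) br_qp dgX mulnK //.
  have -> : q * (q ^+ i * 'X *+ i.+1) - 'X * q ^+ i.+1 * 1 *+ i.+1 = 0.
    by rewrite exprS; ring.
  by rewrite size_poly0.
- move=> _ _ [i ->] [j ->].
  have -> : br D (q ^+ i) (q ^+ j) = 0.
    case: i => [|i]; first by rewrite expr0 (br1l DM).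
    case: j => [|j]; first by rewrite expr0 brC (br1l DM) oppr0.
    by rewrite (brXl DM) (brXr DM) brff mulr0 mul0rn mulr0 mul0rn.
  by rewrite mulr0 size_poly0.
Qed.

(** If dg q does not divide dg p, then a >= 2 and dg q <= dg p <= (a - 1) dg p, so the chain
    excludes [S1]. Otherwise a = 1, and independence would make both leading coefficients of
    degree-one elements multiples of that of q, against [lcS]. *)
Lemma degree_reduction : (dg q <= dg p)%N ->
  dg p = 1%N \/ exists c b, (size (p - (iota c)%:P * q ^+ b)%R <= dg p)%N.
Proof.
move=> le_qp; case: (eqVneq (dg p) 1%N) => [|p1]; [by left | right].
have p2 : (1 < dg p)%N by rewrite ltn_neqAle eq_sym p1; apply: leq_trans q1 _.
have p0 : p != 0 by apply: contraTneq p2 => ->; rewrite size_poly0.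
case: (boolP (dg q %| dg p)%N) => [dv|ndv]; last first.
  have q2 : (1 < dg q)%N.
    by rewrite ltn_neqAle q1 andbT; apply: contraNneq ndv => <-.
  suff : dg (E S1) != 1%N by rewrite dgS1.
  apply: (chain_no_deg1 (N := dg q + dg p) S1 base_stage) => //.
  - by move=> _ [i ->]; rewrite dgX muln_eq1 [dg q == _]gtn_eqF // andbF.
  - rewrite size_poly1 add0n; apply: leq_trans le_qp _; rewrite leq_pmull //.
    have : (1 < dg q %/ gcdn (dg q) (dg p))%N.
      rewrite ltn_divRL ?dvdn_gcdl // mul1n ltn_neqAle dvdn_leq ?dvdn_gcdl // andbT.
      by apply: contraNneq ndv => {1}<-; apply: dvdn_gcdr.
    by move: (_ %/ _)%N => -[|[]].
  - by rewrite size_poly1 add0n.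
have ea : (dg q %/ gcdn (dg q) (dg p))%N = 1%N.
  by move/gcdn_idPl: dv => ->; rewrite divnn q1.
pose SM := qL%:P ^+ (dg p %/ dg q).
have EM : E SM = q ^+ (dg p %/ dg q) by rewrite rmorphXn.
have GM : exists i, E SM = q ^+ i by exists (dg p %/ dg q)%N.
have dgM : dg (E SM) = (dg q %/ gcdn (dg q) (dg p) * dg p)%N.
  by rewrite ea mul1n EM dgX divnK.
have [||[c c0 lcM]|indep] := @iota_closed (lead_coef p ^+ (dg q %/ gcdn (dg q) (dg p))) (lead_coef (E SM)).
- by rewrite expf_neq0 ?lead_coef_eq0.
- by rewrite EM lead_coef_eq0 expf_neq0.
- exists c, (dg p %/ dg q)%N; rewrite -EM; apply: size_sub_lead.
    by rewrite mul_polyC size_scale ?fmorph_eq0 // dgM ea mul1n.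
  by rewrite lead_coefM lead_coefC -lcM ea expr1.
- have deg1 S : dg (E S) = 1%N -> exists2 x, x != 0 & lead_coef (E S) = iota x * lead_coef q.
    move=> dgS; have [i [l [x [hl x0 h ->]]]] := independent_deg1 base_stage GM dgM indep p2 dgS.
    exists x => //; move: hl h; rewrite ea mul1n ltnS leqn0 => /eqP ->.
    rewrite /next_SF /= div0n expr0 mulr1 rmorph1 mulr1 dgX => /eqP.
    by rewrite muln_eq1 => /andP[/eqP -> _].
  have [x x0 h1] := deg1 _ dgS1; have [y y0 h2] := deg1 _ dgS2.
  have := lcS (y / x); rewrite h1 h2 mulrA -rmorphM divfK // eqxx; done.
Qed.

End Core.
End Chain.

(** * The plane over a field *)

Section HomogeneousRelations.
Variable k : fieldType.
Implicit Types A B : {poly k}.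

(** Modulo A only the term with [B ^+ R] survives; as A is not constant, its coefficient is zero,
    and the relation can be divided by A. *)
Lemma coprime_relation A B R (x : 'I_R.+1 -> k) : coprimep A B -> (1 < size A)%N ->
  B != 0 ->
  \sum_(i < R.+1) (x i)%:P * A ^+ i * B ^+ (R - i) = 0 -> forall i, x i = 0.
Proof.
move=> cAB sA B0; have A0 : A != 0 by rewrite -size_poly_gt0; apply: leq_trans sA.
elim: R x => [|R IH] x.
  rewrite big_ord1 subnn !expr0 !mulr1 => /eqP; rewrite polyC_eq0 => /eqP h i.
  by rewrite (ord1 i).
rewrite big_ord_recl subn0 expr0 mulr1 => h.
have x0 : x ord0 = 0.
  have : A %| (x ord0)%:P * B ^+ R.+1.
    have -> : (x ord0)%:P * B ^+ R.+1 = - \sum_(i < R.+1) (x (lift ord0 i))%:P * A ^+ lift ord0 i * B ^+ (R.+1 - lift ord0 i).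
      by apply/eqP; rewrite -addr_eq0 h.
    rewrite dvdpNr; apply: (big_ind (fun p => A %| p)) => [|p q dp dq|i _]; first exact: dvdp0.
      exact: dvdp_add.
    by rewrite lift0 exprS mulrCA -!mulrA dvdp_mulr.
  rewrite Gauss_dvdpl ?coprimep_expr // => dv; apply/eqP; rewrite -polyC_eq0.
  apply: contraTT sA => xx; rewrite -leqNgt.
  by apply: leq_trans (dvdp_leq xx dv) _; rewrite size_polyC leq_b1.
have h' : \sum_(i < R.+1) (x (lift ord0 i))%:P * A ^+ i * B ^+ (R - i) = 0.
  apply: (mulfI A0); rewrite mulr0 -[RHS]h x0 mul0r add0r mulr_sumr.
  by apply: eq_bigr => i _; rewrite lift0 subSS exprS; ring.
move=> i; case: (unliftP ord0 i) => [j ->|->] //; exact: (IH (fun j => x (lift ord0 j)) h').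
Qed.

(** After division by the gcd, either some quotient is not constant and [coprime_relation] applies
    to it, or both are constant. *)
Lemma homogeneous_relation A B : A != 0 -> B != 0 ->
  (exists2 c, c != 0 & A = c%:P * B) \/
  forall R (x : 'I_R.+1 -> k),
    \sum_(i < R.+1) (x i)%:P * A ^+ i * B ^+ (R - i) = 0 -> forall i, x i = 0.
Proof.
move=> A0 B0; pose g := gcdp A B.
have g0 : g != 0 by rewrite gcdp_eq0 (negbTE A0).
have [eA eB] : A = (A %/ g) * g /\ B = (B %/ g) * g.
  by rewrite !divpK ?dvdp_gcdl ?dvdp_gcdr.
set A1 := A %/ g in eA; set B1 := B %/ g in eB.
have A10 : A1 != 0 by apply: contraNneq A0 => h; rewrite eA h mul0r.
have B10 : B1 != 0 by apply: contraNneq B0 => h; rewrite eB h mul0r.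
have cAB : coprimep A1 B1 by apply: coprimep_div_gcd; rewrite A0.
have red R (x : 'I_R.+1 -> k) :
    \sum_(i < R.+1) (x i)%:P * A ^+ i * B ^+ (R - i) = 0 ->
    \sum_(i < R.+1) (x i)%:P * A1 ^+ i * B1 ^+ (R - i) = 0.
  move=> h; apply: (mulIf (expf_neq0 R g0)); rewrite mul0r -[RHS]h mulr_suml.
  apply: eq_bigr => i _; rewrite eA eB !exprMn.
  have -> : g ^+ R = g ^+ i * g ^+ (R - i) by rewrite -exprD subnKC // -ltnS.
  by ring.
case: (ltnP 1 (size A1)) => [sA|sA].
  by right => R x /red; apply: coprime_relation.
case: (ltnP 1 (size B1)) => [sB|sB].
  right => R x /red h i.
  have h' : \sum_(j < R.+1) (x (rev_ord j))%:P * B1 ^+ j * A1 ^+ (R - j) = 0.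
    rewrite -[RHS]h [RHS](reindex_inj rev_ord_inj) /=; apply: eq_bigr => j _.
    have jR : (j <= R)%N by rewrite -ltnS.
    by rewrite subSS subKn // mulrAC.
  have := coprime_relation _ sB A10 h' (rev_ord i).
  by rewrite rev_ordK coprimep_sym => ->.
left; move: (size1_polyC sA) (size1_polyC sB) => hA hB.
move: (A1`_0) (B1`_0) hA hB => u v hA hB.
have u0 : u != 0 by rewrite -polyC_eq0 -hA.
have v0 : v != 0 by rewrite -polyC_eq0 -hB.
exists (u / v); first by rewrite mulf_neq0 ?invr_eq0.
by rewrite eA eB hA hB mulrA -polyCM divfK.
Qed.

End HomogeneousRelations.

(** * From the plane to k[t][z] *)

Section Dehomogenization.
Variable k : fieldType.
Local Notation T := {poly k}.
Local Notation B := {poly {poly k}}.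
Local Notation R2 := {mpoly k[2]}.

Lemma ord2P (i : 'I_2) : i = i0 \/ i = i1.
Proof. by case: (unliftP ord0 i) => [j ->|->]; [right; rewrite (ord1 j) | left]. Qed.

(* With x = t z and y = z, the degree of a polynomial in x and y becomes its
   degree in z, and its leading form becomes its leading coefficient. *)
Definition dehom : R2 -> B :=
  mmap (polyC \o polyC) (fun i : 'I_2 => if i == i0 then 'X%:P * 'X else 'X).

HB.instance Definition _ := GRing.RMorphism.on dehom.

Lemma dehomC c : dehom c%:MP = c%:P%:P.
Proof. exact: mmapC. Qed.

Lemma dehomX i : dehom 'X_i = if i == i0 then 'X%:P * 'X else 'X.
Proof. by rewrite /dehom mmapX mmap1U. Qed.

Lemma coef_derivX : coef_deriv (@deriv k) 'X = 0.
Proof.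
apply/polyP => i; rewrite coef_coef_deriv coefX coef0.
by case: eqP => _; rewrite ?raddf0 //= -polyC1 derivC.
Qed.

Lemma dehom_deriv f :
  (dehom f)^`() = dehom f^`M(i0) * 'X%:P + dehom f^`M(i1) /\
  coef_deriv (@deriv k) (dehom f) = dehom f^`M(i0) * 'X.
Proof.
split; elim/mpoly_ring_ind: f => [c|i|p q IHp IHq|p q IHp IHq].
- by rewrite dehomC !mderivC rmorph0 derivC mul0r addr0.
- rewrite dehomX !mderivXi; case: (ord2P i) => -> /=.
    by rewrite rmorph1 rmorph0 mul1r addr0 derivM derivC derivX mul0r add0r mulr1.
  by rewrite rmorph1 rmorph0 mul0r add0r derivX.
- by rewrite !mderivD !rmorphD /= derivD IHp IHq; ring.
- by rewrite !mderivM !rmorphD !rmorphM /= derivM IHp IHq; ring.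
- by rewrite dehomC !mderivC rmorph0 mul0r coef_derivC /= derivC polyC0.
- rewrite dehomX !mderivXi; case: (ord2P i) => -> /=.
    rewrite rmorph1 mul1r (coef_derivM (@derivM k)) coef_derivC coef_derivX /= derivX.
    by rewrite mulr0 addr0 polyC1 mul1r.
  by rewrite rmorph0 mul0r coef_derivX.
- by rewrite !mderivD !rmorphD /= coef_derivD IHp IHq; ring.
- by rewrite !mderivM !rmorphD !rmorphM /= (coef_derivM (@derivM k)) IHp IHq; ring.
Qed.

(** The factor 'X is the Jacobian determinant, up to sign, of the substitution (t, z) -> (t z,
    z). *)
Lemma br_dehom f g : br (@deriv k) (dehom f) (dehom g) =
  'X * dehom (g^`M(i0) * f^`M(i1) - g^`M(i1) * f^`M(i0)).
Proof.
have [hf hf'] := dehom_deriv f; have [hg hg'] := dehom_deriv g.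
by rewrite /br hf hf' hg hg' rmorphB !rmorphM /=; ring.
Qed.

Lemma coef_dehom f N i : (i <= N)%N ->
  (dehom f)`_N`_i = f@_[multinom if j == i0 then i else (N - i)%N | j < 2].
Proof.
move=> iN; elim/mpolyind: f => [|c m p _ _ IH]; first by rewrite rmorph0 !coef0 mcoeff0.
rewrite rmorphD /= !coefD mcoeffD IH; congr (_ + _).
have -> : dehom (c *: 'X_[m]) = (c%:P * 'X^(m i0))%:P * 'X^(m i0 + m i1).
  rewrite -mul_mpolyC rmorphM /= dehomC /dehom mmapX /mmap1 !big_ord_recl big_ord0 mulr1 /=.
  by rewrite exprMn exprD polyCM !rmorphXn /=; ring.
rewrite coefCM coefXn mcoeffZ mcoeffX.
have -> : (m == [multinom if j == i0 then i else (N - i)%N | j < 2]) = (m i0 == i) && (N == m i0 + m i1)%N.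
  apply/eqP/andP => [->|[/eqP h1 /eqP h2]].
    by rewrite !mnmE /= subnKC.
  apply/mnmP => j; rewrite mnmE; case: (ord2P j) => -> /=; first exact: h1.
  by rewrite h2 h1 addKn.
case: (N == _)%N; last by rewrite mulr0 coef0 andbF mulr0.
rewrite mulr1 coefCM coefXn andbT eq_sym.
by [].
Qed.
End Dehomogenization.

Lemma det_mx2 (S : comNzRingType) (M : 'M[S]_2) :
  \det M = M i0 i0 * M i1 i1 - M i0 i1 * M i1 i0.
Proof.
rewrite (expand_det_row M i0) !big_ord_recl big_ord0 addr0 /cofactor !det_mx11 !mxE.
rewrite (_ : lift i0 0 = i1); last exact: val_inj.
rewrite (_ : lift i1 0 = i0); last exact: val_inj.
by rewrite /bump /= expr0 expr1; ring.
Qed.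

Section Plane.
Variable R : comNzRingType.
Implicit Types (F G : {mpoly R[2]}) (phi : polymap R 2).

Definition pm2 F G : polymap R 2 := [tuple if i == i0 then F else G | i < 2].

Lemma tnth_pm2 F G i : tnth (pm2 F G) i = if i == i0 then F else G.
Proof. exact: tnth_mktuple. Qed.

Lemma pm2_eta phi : phi = pm2 (tnth phi i0) (tnth phi i1).
Proof. by apply: eq_from_tnth => i; rewrite tnth_pm2; case: (ord2P i) => ->. Qed.

Lemma pm2_id : pm_id R 2 = pm2 'X_i0 'X_i1.
Proof. by rewrite [LHS]pm2_eta !tnth_pm_id. Qed.

Lemma elementary0_comp f F G :
  pm_comp (elementary i0 f) (pm2 F G) = pm2 (F + (f \mPo pm2 F G)) G.
Proof.
rewrite [LHS]pm2_eta !tnth_pm_comp !tnth_elementary /= comp_mpolyD !comp_mpolyXi.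
by rewrite !tnth_pm2.
Qed.

Lemma elementary1_comp f F G :
  pm_comp (elementary i1 f) (pm2 F G) = pm2 F (G + (f \mPo pm2 F G)).
Proof.
rewrite [LHS]pm2_eta !tnth_pm_comp !tnth_elementary /= comp_mpolyD !comp_mpolyXi.
by rewrite !tnth_pm2.
Qed.

Lemma free_mono (i j : 'I_2) (c : R) b : i != j -> free_of_var i (c%:MP * 'X_j ^+ b).
Proof.
move=> ij; rewrite mpolyXn mul_mpolyC; apply/free_of_varZ/free_of_varX.
by rewrite mulmnE mnm1E eq_sym (negbTE ij).
Qed.

Lemma comp_mono (j : 'I_2) (c : R) b phi :
  (c%:MP * 'X_j ^+ b) \mPo phi = c%:MP * tnth phi j ^+ b.
Proof.
by rewrite comp_mpolyM comp_mpolyC; congr (_ * _); rewrite rmorphXn /= comp_mpolyXi.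
Qed.

Lemma EA_op0 (c : R) b F G : EA (pm2 (F + c%:MP * G ^+ b) G) -> EA (pm2 F G).
Proof.
move=> h; apply: (@EA_cancel _ _ (elementary i0 (c%:MP * 'X_i1 ^+ b))).
  by apply: EA_elementary; apply: free_mono.
by rewrite elementary0_comp comp_mono tnth_pm2.
Qed.

Lemma EA_op1 (c : R) b F G : EA (pm2 F (G + c%:MP * F ^+ b)) -> EA (pm2 F G).
Proof.
move=> h; apply: (@EA_cancel _ _ (elementary i1 (c%:MP * 'X_i0 ^+ b))).
  by apply: EA_elementary; apply: free_mono.
by rewrite elementary1_comp comp_mono tnth_pm2.
Qed.

(** The sign keeps the Jacobian determinant 1, where a plain swap has -1. *)
Definition pm_rot : polymap R 2 := pm2 'X_i1 (- 'X_i0).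

Lemma EA_rot : EA pm_rot.
Proof.
apply: (@EA_op0 (-1) 1); apply: (@EA_op1 1 1); apply: (@EA_op0 (-1) 1).
rewrite (_ : pm2 _ _ = pm_id R 2); first exact: EA_id.
by rewrite pm2_id !expr1 mpolyCN !mpolyC1; congr pm2; ring.
Qed.

Lemma rot_comp F G : pm_comp pm_rot (pm2 F G) = pm2 G (- F).
Proof.
by rewrite [LHS]pm2_eta !tnth_pm_comp !tnth_pm2 /= comp_mpolyN !comp_mpolyXi !tnth_pm2.
Qed.

Lemma SA_EA_comp n (eps phi : polymap R n) :
  EA eps -> SA phi -> SA (pm_comp eps phi).
Proof.
move=> he [[psi hpsi] hdet]; split.
  have [eps' he'] := EA_GA he; exists (pm_comp psi eps').
  exact: pm_inverse_comp.
by rewrite det_jacobian_comp (det_jacobian_EA he) hdet comp_mpoly1 mulr1.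
Qed.

Lemma det_jacobian2 F G : \det (jacobian (pm2 F G)) =
  F^`M(i0) * G^`M(i1) - F^`M(i1) * G^`M(i0).
Proof. by rewrite det_mx2 !mxE !tnth_pm2. Qed.

End Plane.

Section Linear.
Variable k : fieldType.

Lemma EA_linear (a1 a2 b1 b2 : k) : a1 * b2 - a2 * b1 = 1 ->
  EA (pm2 (a1%:MP * 'X_i0 + a2%:MP * 'X_i1) (b1%:MP * 'X_i0 + b2%:MP * 'X_i1)).
Proof.
move=> det1; wlog b10 : b1 b2 det1 / b1 != 0.
  move=> W; case: (eqVneq b1 0) => [b0|]; last exact: W.
  apply: (@EA_op1 _ 1 1).
  have -> : b1%:MP * 'X_i0 + b2%:MP * 'X_i1 + 1%:MP * (a1%:MP * 'X_i0 + a2%:MP * 'X_i1) ^+ 1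
     = (b1 + a1)%:MP * 'X_i0 + (b2 + a2)%:MP * 'X_i1 :> {mpoly k[2]}.
    by rewrite !mpolyCD mpolyC1; ring.
  apply: W; first by rewrite -[RHS]det1; ring.
  rewrite b0 add0r; apply/eqP => a0; move: det1; rewrite b0 a0 mul0r mulr0 subr0 => /eqP.
  by rewrite eq_sym oner_eq0.
(* This multiple of the second row makes the upper left entry 1; the next two operations clear the
   entries off the diagonal. *)
apply: (@EA_op0 _ ((1 - a1) / b1) 1); apply: (@EA_op1 _ (- b1) 1).
apply: (@EA_op0 _ (- (a2 + (1 - a1) / b1 * b2)) 1).
rewrite (_ : pm2 _ _ = pm_id k 2); first exact: EA_id.
rewrite pm2_id !expr1; set t := (1 - a1) / b1.
have tb : t * b1 = 1 - a1 by rewrite /t divfK.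
have hF : a1%:MP * 'X_i0 + a2%:MP * 'X_i1 + t%:MP * (b1%:MP * 'X_i0 + b2%:MP * 'X_i1)
   = 'X_i0 + (a2 + t * b2)%:MP * 'X_i1 :> {mpoly k[2]}.
  rewrite -[in RHS](mul1r 'X_i0) -mpolyC1 (_ : 1 = a1 + t * b1); last by rewrite tb; ring.
  by rewrite !mpolyCD !mpolyCM; ring.
have hG : b1%:MP * 'X_i0 + b2%:MP * 'X_i1 + (- b1)%:MP * ('X_i0 + (a2 + t * b2)%:MP * 'X_i1)
   = 'X_i1 :> {mpoly k[2]}.
  rewrite -[in RHS](mul1r 'X_i1) -mpolyC1 (_ : 1 = b2 - b1 * (a2 + t * b2)).
    by rewrite mpolyCN mpolyCB mpolyCM; ring.
  rewrite -det1; transitivity (b2 - a2 * b1 - (t * b1) * b2); last by ring.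
  by rewrite tb; ring.
by rewrite hF hG; congr pm2; rewrite mpolyCN; ring.
Qed.

Lemma EA_affine (a0 a1 a2 b0 b1 b2 : k) : a1 * b2 - a2 * b1 = 1 ->
  EA (pm2 (a0%:MP + (a1%:MP * 'X_i0 + a2%:MP * 'X_i1))
          (b0%:MP + (b1%:MP * 'X_i0 + b2%:MP * 'X_i1))).
Proof.
move=> h; apply: (@EA_op0 _ (- a0) 0); apply: (@EA_op1 _ (- b0) 0).
rewrite (_ : pm2 _ _ = pm2 (a1%:MP * 'X_i0 + a2%:MP * 'X_i1) (b1%:MP * 'X_i0 + b2%:MP * 'X_i1)).
  exact: EA_linear.
by rewrite !expr0 !mpolyCN; congr pm2; ring.
Qed.

End Linear.

(** * Automorphisms of Jacobian 1 over a field are elementary *)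

Section JungVanDerKulk.
Variable k : fieldType.
Local Notation B := {poly {poly k}}.

Definition eval1 (q : B) : {poly k} -> B :=
  horner_eval q \o map_poly (polyC \o polyC).
HB.instance Definition _ (q : B) := GRing.RMorphism.on (eval1 q).

(** Polynomials in p over k[q] are kept formal and evaluated here, because the chain uses their
    degree in p and their monicity. *)
Definition eval2 (p q : B) : {poly {poly k}} -> B :=
  horner_eval p \o map_poly (eval1 q).
HB.instance Definition _ (p q : B) := GRing.RMorphism.on (eval2 p q).

Lemma eval2C (p q : B) (g : {poly k}) : eval2 p q g%:P = eval1 q g.
Proof. by rewrite /eval2 /= map_polyC /horner_eval hornerC. Qed.

Lemma eval1C (q : B) (c : k) : eval1 q c%:P = c%:P%:P.
Proof. by rewrite /eval1 /= map_polyC /horner_eval hornerC. Qed.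

Lemma eval1X (q : B) : eval1 q 'X = q.
Proof. by rewrite /eval1 /= map_polyX /horner_eval hornerX. Qed.

Lemma eval2X (p q : B) : eval2 p q 'X = p.
Proof. by rewrite /eval2 /= map_polyX /horner_eval hornerX. Qed.

Lemma eval1_lead (q : B) (g : {poly k}) : (0 < dg q)%N -> eval1 q g = 0 \/
  exists i x, [/\ x != 0, eval1 q g != 0, dg (eval1 q g) = (i * dg q)%N
    & lead_coef (eval1 q g) = x%:P * lead_coef q ^+ i].
Proof.
move=> q1; have -> : eval1 q g = map_poly polyC g \Po q.
  by rewrite /eval1 /comp_poly /= /horner_eval map_poly_comp.
case: (eqVneq g 0) => [->|g0]; [by left; rewrite rmorph0 comp_poly0 | right].
have sq : (1 < size q)%N by move: q1; case: (size q) => // -[].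
exists (size g).-1, (lead_coef g); split.
- by rewrite lead_coef_eq0.
- rewrite -lead_coef_eq0 lead_coef_comp // mulf_neq0 ?expf_neq0 ?lead_coef_eq0 //.
    by rewrite map_polyC_eq0.
  by rewrite -size_poly_gt0; apply: leq_trans sq.
- by rewrite size_comp_poly size_map_polyC.
- by rewrite lead_coef_comp // lead_coef_map_inj ?rmorph0 ?size_map_polyC //; apply: polyC_inj.
Qed.

Definition lift2 : {mpoly k[2]} -> {poly {poly k}} :=
  mmap (polyC \o polyC) (fun i : 'I_2 => if i == i0 then 'X else 'X%:P).
HB.instance Definition _ := GRing.RMorphism.on lift2.

Lemma eval2_lift2 F G f :
  eval2 (dehom F) (dehom G) (lift2 f) = dehom (f \mPo pm2 F G).
Proof.
elim/mpoly_ring_ind: f => [c|i|p q IHp IHq|p q IHp IHq].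
- by rewrite comp_mpolyC dehomC /lift2 mmapC /= eval2C eval1C.
- rewrite comp_mpolyXi tnth_pm2 /lift2 mmapX mmap1U.
  by case: eqP => _; rewrite ?eval2X // eval2C eval1X.
- by rewrite comp_mpolyD !rmorphD /= IHp IHq.
- by rewrite comp_mpolyM !rmorphM /= IHp IHq.
Qed.

(** The part of degree 0 in z is a constant of k, for which the bracket would vanish. *)
Lemma dg_dehom_gt0 F G : br (@deriv k) (dehom G) (dehom F) = 'X -> (0 < dg (dehom G))%N.
Proof.
rewrite lt0n; apply: contra_eqN => /eqP dg0.
have [c hc] : exists c : k, (dehom G)`_0 = c%:P.
  elim/mpoly_ring_ind: (G) => [c|i|p q [a ha] [b hb]|p q [a ha] [b hb]].
  - by exists c; rewrite dehomC coefC.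
  - exists 0; rewrite dehomX; case: eqP => _; rewrite ?coefCM coefX /= ?mulr0 //.
  - by exists (a + b); rewrite rmorphD coefD ha hb polyCD.
  - by exists (a * b); rewrite rmorphM coef0M ha hb polyCM.
have -> : dehom G = c%:P%:P.
  rewrite -hc; apply: size1_polyC; move: dg0; case: (size _) => // n /= ->; done.
by rewrite brC (br_cstr _ (derivC c)) oppr0 eq_sym polyX_eq0.
Qed.

Lemma size_dehomN (F : {mpoly k[2]}) : size (dehom (- F)) = size (dehom F).
Proof. by rewrite (_ : dehom (- F) = - dehom F) ?size_polyN //; apply: rmorphN. Qed.

Lemma dehom_sub_monomial (F G : {mpoly k[2]}) c b :
  dehom (F - c%:MP * G ^+ b) = dehom F - c%:P%:P * dehom G ^+ b.
Proof. by rewrite -dehomC -rmorphXn -rmorphM -rmorphB. Qed.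

Lemma SA2_degree_reduction (F G : {mpoly k[2]}) : SA (pm2 F G) -> (dg (dehom G) <= dg (dehom F))%N ->
  (dg (dehom F) = 1%N /\ dg (dehom G) = 1%N) \/
  exists c b, (size (dehom (F - c%:MP * G ^+ b)%R) < size (dehom F))%N.
Proof.
move=> [[psi [_ hpsi]] hdet] le_dg.
have hbr : br (@deriv k) (dehom G) (dehom F) = 'X.
  by rewrite br_dehom -det_jacobian2 hdet rmorph1 mulr1.
have G1 := dg_dehom_gt0 hbr.
have hX i : eval2 (dehom F) (dehom G) (lift2 (tnth psi i)) = dehom 'X_i.
  by rewrite eval2_lift2 -tnth_pm_comp hpsi tnth_pm_id.
(* The last two arguments come from the inverse map. They evaluate to z and t z, of degree 1 with
   leading coefficients 1 and t. *)
have [] := @degree_reduction {poly k} (@deriv k) (@derivM k) k polyC (@derivC k) {poly k}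
  (eval2 (dehom F) (dehom G)) 'X polyC _ _ (@homogeneous_relation k) _ _
  (lift2 (tnth psi i1)) (lift2 (tnth psi i0)).
- by move=> c; rewrite /= eval2C eval1C.
- by move=> g; rewrite /= !eval2C eval1X; apply: eval1_lead.
- by rewrite /= eval2C eval1X eval2X.
- by rewrite /= eval2C eval1X.
- by rewrite /= hX dehomX size_polyX.
- by rewrite /= hX dehomX eqxx size_mulX ?polyC_eq0 ?polyX_eq0 // size_polyC polyX_eq0.
- move=> c; rewrite /= !hX !dehomX eqxx /= lead_coefM !lead_coefX lead_coefC !mulr1.
  by apply/eqP => /(congr1 (fun p : {poly k} => size p)); rewrite size_polyX size_polyC; case: (c == 0).
- by rewrite /= eval2C eval1X eval2X.
- by rewrite /= eval2X => F1; left; split => //; apply/eqP; rewrite eqn_leq G1 -F1 le_dg.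
rewrite /= eval2X eval2C eval1X => -[c [b h]]; right; exists c, b.
rewrite dehom_sub_monomial (leq_ltn_trans h) // ltn_predL.
by apply: leq_trans (leq_pred _); apply: leq_trans le_dg.
Qed.

Lemma affine_of_dg1 (F : {mpoly k[2]}) : dg (dehom F) = 1%N ->
  F = (F@_0%MM)%:MP + ((F@_U_(i0)%MM)%:MP * 'X_i0 + (F@_U_(i1)%MM)%:MP * 'X_i1).
Proof.
move=> F1; apply/mpolyP => m.
rewrite !mcoeffD !mul_mpolyC !mcoeffZ mcoeffC !mcoeffX.
case: (leqP 2 (m i0 + m i1)) => hm.
  have -> : F@_m = 0.
    have -> : m = [multinom if j == i0 then m i0 else (m i0 + m i1 - m i0)%N | j < 2].
      by apply/mnmP => j; rewrite mnmE addKn; case: (ord2P j) => ->.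
    have sF : (size (dehom F) <= m i0 + m i1)%N.
      by apply: leq_trans hm; apply: leq_trans (leqSpred _) _; rewrite F1.
    by rewrite -coef_dehom ?leq_addr // (nth_default _ sF) coef0.
  have h0 : m == 0%MM = false by apply/eqP => e; move: hm; rewrite e !mnmE.
  have h1 : (U_(i0)%MM == m) = false by apply/eqP => e; move: hm; rewrite -e !mnmE.
  have h2 : (U_(i1)%MM == m) = false by apply/eqP => e; move: hm; rewrite -e !mnmE.
  by rewrite h0 h1 h2 !mulr0 !addr0.
have mE : m = [multinom if j == i0 then m i0 else m i1 | j < 2].
  by apply/mnmP => j; rewrite mnmE; case: (ord2P j) => ->.
move: mE hm; case: (m i0) => [|[|a]]; case: (m i1) => [|[|b]] //= mE _.
- have -> : m = 0%MM by rewrite mE; apply/mnmP => j; rewrite !mnmE; case: (ord2P j) => ->.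
  by rewrite eqxx !mnm1_eq0 mulr1 !mulr0 !addr0.
- have -> : m = U_(i1)%MM by rewrite mE; apply/mnmP => j; rewrite !mnmE; case: (ord2P j) => ->.
  by rewrite mnm1_eq0 eq_mnm1 eqxx mulr1 !mulr0 !add0r.
- have -> : m = U_(i0)%MM by rewrite mE; apply/mnmP => j; rewrite !mnmE; case: (ord2P j) => ->.
  by rewrite mnm1_eq0 !eq_mnm1 eqxx (_ : (i1 == i0) = false) // mulr1 !mulr0 add0r addr0.
Qed.

Lemma SA2_field_EA (phi : polymap k 2) : SA phi -> EA phi.
Proof.
rewrite (pm2_eta phi); move: (tnth phi i0) (tnth phi i1) => F G {phi}.
have [n] := ubnP (size (dehom F) + size (dehom G)).
elim: n F G => // n IH F G; rewrite ltnS => hn hS.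
wlog le_dg : F G hn hS / (dg (dehom G) <= dg (dehom F))%N.
  move=> W; case: (leqP (dg (dehom G)) (dg (dehom F))) => [|/ltnW le]; first exact: W.
  apply: (EA_cancel (EA_rot k)); rewrite rot_comp; apply: W.
  - by rewrite size_dehomN addnC.
  - by rewrite -rot_comp; apply: SA_EA_comp => //; apply: EA_rot.
  - by rewrite size_dehomN.
have [[F1 G1]|[c [b lt_sz]]]   := SA2_degree_reduction hS le_dg.
  have [_] := hS; rewrite (affine_of_dg1 F1) (affine_of_dg1 G1).
  move: (F@_0%MM) (G@_0%MM) (F@_U_(i0)%MM) (F@_U_(i1)%MM) (G@_U_(i0)%MM) (G@_U_(i1)%MM) => a0 b0 a1 a2 b1 b2.
  rewrite det_jacobian2 !mderivD !mderivM !mderivC !mderivXi /= => h.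
  apply: EA_affine; apply: (can_inj (@mpolyCK 2 k)); rewrite mpolyC1 -h mpolyCB !mpolyCM; ring.
apply: (@EA_op0 _ (- c) b); apply: IH.
  apply: leq_trans hn; rewrite -addSn leq_add2r.
  by rewrite mpolyCN mulNr.
have -> : pm2 (F + (- c)%:MP * G ^+ b) G = pm_comp (elementary i0 ((- c)%:MP * 'X_i1 ^+ b)) (pm2 F G).
  by rewrite elementary0_comp comp_mono tnth_pm2.
by apply: SA_EA_comp => //; apply: EA_elementary; apply: free_mono.
Qed.

End JungVanDerKulk.

(** * Quotients and Artinian rings *)

Section QuotientByIdeal.
Variables (A : comNzRingType) (I : A -> Prop).
Hypotheses (hI : is_ideal I) (I1 : ~ I 1).

Definition idealb (x : A) : bool :=
  if excluded_middle_informative (I x) then true else false.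

Lemma idealbP x : idealb x <-> I x.
Proof. by rewrite /idealb; case: excluded_middle_informative. Qed.

Lemma idealb_closed : idealr_closed idealb.
Proof.
have [I0 ID IM] := hI; split; first exact/idealbP.
  by apply/negP => /idealbP.
by move=> a x y /idealbP Ix /idealbP Iy; apply/idealbP; apply: ID => //; apply: IM.
Qed.

HB.instance Definition _ := isIdealr.Build A idealb idealb_closed.

Lemma exists_quotient : exists (Q : comNzRingType) (pi : {rmorphism A -> Q}),
  (forall y, exists x, pi x = y) /\ (forall x, pi x = 0 <-> I x).
Proof.
pose J : idealr A := idealb; pose Q : comNzRingType := {ideal_quot J}.
pose p : {rmorphism A -> Q} := (\pi_{ideal_quot J})%qT.
exists Q, p; split=> [y|x]; first by exists (repr y); rewrite /p /= reprK.
rewrite -idealbP -[idealb x]/(x \in J) -[x]subr0 Quotient.idealrBE subr0.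
have -> : (p x = 0) <-> (p x = p 0) by rewrite rmorph0.
by split=> [h|/eqP]; first exact/eqP.
Qed.

End QuotientByIdeal.

Section FieldOfInverses.
Variable Q : comNzRingType.
Hypothesis inverses : forall x : Q, x != 0 -> exists y, y * x == 1.

Definition field_copy : Type := Q.
HB.instance Definition _ := GRing.ComNzRing.on field_copy.

(** The boolean form allows [xchoose], and the first alternative fixes the value 0 at 0. *)
Lemma exists_inv (x : field_copy) :
  exists y, ((x == 0) && (y == 0)) || (y * x == 1).
Proof.
case: (eqVneq x 0) => [->|x0]; first by exists 0; rewrite eqxx.
by have [y hy] := inverses x0; exists y.
Qed.

Definition field_inv (x : field_copy) : field_copy := xchoose (exists_inv x).

Lemma field_invP x : ((x == 0) && (field_inv x == 0)) || (field_inv x * x == 1).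
Proof. exact: xchooseP (exists_inv x). Qed.

Lemma field_mulVf x : x != 0 -> field_inv x * x = 1.
Proof.
by move=> x0; have := field_invP x; rewrite (negbTE x0) => /eqP.
Qed.

Lemma field_inv0 : field_inv 0 = 0.
Proof.
by have := field_invP 0; rewrite eqxx mulr0 [0 == 1]eq_sym oner_eq0 orbF => /eqP.
Qed.

HB.instance Definition _ :=
  GRing.ComNzRing_isField.Build field_copy field_mulVf field_inv0.

Lemma exists_field : exists (K : fieldType) (f : {rmorphism Q -> K}), bijective f.
Proof.
pose f : {rmorphism Q -> field_copy} := idfun.
by exists field_copy, f; exists id.
Qed.
End FieldOfInverses.

Section Ideals.
Variable A : comNzRingType.
Implicit Types I J : A -> Prop.

Lemma is_ideal_inter I J : is_ideal I -> is_ideal J -> is_ideal (fun x => I x /\ J x).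
Proof.
move=> [I0 ID IM] [J0 JD JM]; split=> [//|x y [Ix Jx] [Iy Jy]|a x [Ix Jx]].
  by split; [apply: ID | apply: JD].
by split; [apply: IM | apply: JM].
Qed.

Definition principal (y x : A) : Prop := exists r, x = y * r.

Lemma is_ideal_principal y : is_ideal (principal y).
Proof.
split=> [|_ _ [r ->] [s ->]|a _ [r ->]]; first by exists 0; rewrite mulr0.
  by exists (r + s); rewrite mulrDr.
by exists (a * r); rewrite mulrCA.
Qed.

Lemma is_idealMr I x a : is_ideal I -> I x -> I (x * a).
Proof. by move=> [_ _ IM] Ix; rewrite mulrC; apply: IM. Qed.

Definition nilpotent_element (x : A) := exists n, x ^+ n = 0.

Lemma nilpotent_mul x a : nilpotent_element x -> nilpotent_element (a * x).
Proof. by case=> n xn; exists n; rewrite exprMn xn mulr0. Qed.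

Lemma nilpotent_add x y :
  nilpotent_element x -> nilpotent_element y -> nilpotent_element (x + y).
Proof.
move=> [n xn] [m ym]; exists (n + m)%N; rewrite exprDn big1 // => i _.
case: (leqP m i) => hi.
  by rewrite -(subnK hi) exprD ym !mulr0 mul0rn.
have hn : (n <= n + m - i)%N by lia.
by rewrite -(subnK hn) exprD xn mulr0 mul0r mul0rn.
Qed.

Lemma nilpotent_unit x : nilpotent_element x -> exists y, (1 - x) * y = 1.
Proof.
move=> [n xn]; exists (\sum_(i < n) x ^+ i).
by rewrite -opprB mulNr -subrX1 xn sub0r opprK.
Qed.

Section Artinian.
Hypothesis hA : artinian A.

(** Without a minimal member, choice would produce a strictly decreasing sequence of ideals. *)
Lemma artinian_minimal (P : (A -> Prop) -> Prop) I0 :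
  is_ideal I0 -> P I0 -> exists I, [/\ is_ideal I, P I &
    forall J, is_ideal J -> P J -> (forall x, J x -> I x) -> forall x, I x -> J x].
Proof.
move=> id0 P0; apply: NNPP => nomin.
pose S := {I : A -> Prop | is_ideal I /\ P I}.
have step (s : S) : exists t : S, (forall x, sval t x -> sval s x) /\
    exists x, sval s x /\ ~ sval t x.
  case: s => I [iI PI] /=; apply: NNPP => no; apply: nomin.
  exists I; split => // J iJ PJ JI x Ix; apply: NNPP => nJx; apply: no.
  by exists (exist _ J (conj iJ PJ)); split => //; exists x.
pose next s := sval (constructive_indefinite_description _ (step s)).
have nextP s := svalP (constructive_indefinite_description _ (step s)).
pose f n := iter n next (exist _ I0 (conj id0 P0) : S).
have [n|n x|N hN] := @hA (fun n => sval (f n)).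
- by have [] := svalP (f n).
- by have [h _] := nextP (f n); apply: h.
have [_ [x [fx nfx]]] := nextP (f N).
by apply: nfx; apply/(hN N.+1).
Qed.

(** The chain of ideals (y^k) stabilizes, so y^(N+1) = y^(2N+2) r for some N and r. Then y^(N+1) r
    is idempotent, and it is zero only if y^(N+1) is. *)
Lemma artinian_idempotent y : ~ nilpotent_element y ->
  exists r, [/\ (y * r) * (y * r) = y * r & y * r != 0].
Proof.
move=> ny; have [k|k x|N hN] := @hA (fun k => principal (y ^+ k)).
- exact: is_ideal_principal.
- by move=> [r ->]; exists (y * r); rewrite exprSr mulrA.
have : principal (y ^+ N) (y ^+ N.+1) by exists y; rewrite exprSr.
have le2 : (N <= N.+1 + N.+1)%N by lia.
move/(hN _ le2) => -[r hr]; exists (y ^+ N * r).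
have e : y * (y ^+ N * r) = y ^+ N.+1 * r by rewrite exprS mulrA.
rewrite e; split.
  by rewrite mulrACA -exprD mulrA -hr.
apply/eqP => h; apply: ny; exists N.+1.
by rewrite hr exprD -mulrA h mulr0.
Qed.

(* The maximal ideal is the kernel of A -> eA / nil(eA), for an idempotent e
   in I whose ideal is minimal. *)
Lemma artinian_maximal I y : is_ideal I -> I y -> ~ nilpotent_element y ->
  exists m e, [/\ is_ideal m, ~ m 1, I e, ~ m e
    & forall x, ~ m x -> exists s, m (1 - x * s)].
Proof.
move=> iI Iy ny.
pose P K := exists e, [/\ e * e = e, e != 0, I e & forall x, K x <-> principal e x].
have [r [rr r0]] := artinian_idempotent ny.
have [||K [iK [e [ee e0 Ie Ke]] Kmin]] := @artinian_minimal P (principal (y * r)).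
- exact: is_ideal_principal.
- by exists (y * r); split => //; apply: is_idealMr.
pose m x := nilpotent_element (x * e).
have eX n : e ^+ n.+1 = e by elim: n => [|n IH]; [rewrite expr1 | rewrite exprS IH].
have ne : ~ nilpotent_element e.
  by case=> -[|n]; [rewrite expr0 => /eqP; rewrite oner_eq0 | rewrite eX => h; rewrite h eqxx in e0].
exists m, e; split => //.
- split=> [|x z mx mz|a x mx]; first by exists 1%N; rewrite mul0r expr1.
    by rewrite /m mulrDl; apply: nilpotent_add.
  by rewrite /m -mulrA; apply: nilpotent_mul.
- by rewrite /m mul1r.
- by rewrite /m ee.
(* Since x e is not nilpotent it has an idempotent multiple g; by minimality g generates the same
   ideal as e, so e is a multiple of x e. *)
move=> x nmx; have [s [ss s0]] := artinian_idempotent nmx.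
set g := x * e * s in ss s0.
have ge : principal e g by exists (x * s); rewrite /g; ring.
have Pg : P (principal g).
  by exists g; split => //; have [t ->] := ge; apply: is_idealMr.
have [||t ht] := Kmin _ (is_ideal_principal g) Pg _ e.
- by move=> _ [t ->]; apply/Ke; have [u ->] := ge; exists (u * t); rewrite mulrA.
- by apply/Ke; exists 1; rewrite mulr1.
exists (e * s * t); rewrite /m; exists 1%N; rewrite expr1 mulrBl mul1r.
have -> : x * (e * s * t) = e by rewrite {2}ht /g; ring.
by rewrite ee subrr.
Qed.

End Artinian.
End Ideals.

(** * Reduction modulo a nil ideal *)

Section Lifting.
Variables (A Q : comNzRingType) (pi : {rmorphism A -> Q}).
Hypothesis pi_surj : forall y, exists x, pi x = y.

Lemma mpoly_lift n (i : 'I_n) (g : {mpoly Q[n]}) : free_of_var i g ->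
  exists h : {mpoly A[n]}, free_of_var i h /\ map_mpoly pi h = g.
Proof.
move=> gi; pose s y := sval (constructive_indefinite_description _ (pi_surj y)).
have sK y : pi (s y) = y := svalP (constructive_indefinite_description _ (pi_surj y)).
exists (\sum_(m <- msupp g) s g@_m *: 'X_[m]); split.
  rewrite big_seq; apply: (big_ind (fun h => free_of_var i h)) => [|h h'|m hm].
  - by rewrite -mpolyC0; apply: free_of_varC.
  - exact: free_of_varD.
  - by apply/free_of_varZ/free_of_varX/gi.
rewrite [RHS]mpolyE raddf_sum; apply: eq_bigr => m _.
by rewrite /= map_mpolyZ sK map_mpolyX.
Qed.

Variables (f : A) (n : nat) (Z : polymap A n -> Prop).
Hypothesis pif : pi f = 1.
Hypothesis Z_id : Z (pm_id A n).
Hypothesis Z_comp : forall phi psi, Z phi -> Z psi -> Z (pm_comp phi psi).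
Hypothesis Z_inv : forall phi psi, Z phi -> pm_inverse phi psi -> Z psi.
Hypothesis Z_elementary : forall i g, free_of_var i g -> Z (elementary i (f *: g)).

(** Scaling the lifted polynomials by f does not change their images, as [pi f = 1]. With f in an
    ideal, Z can record that the lift is trivial modulo that ideal. *)
Lemma EA_lift (eps : polymap Q n) : EA eps ->
  exists eps', [/\ EA eps', pm_map pi eps' = eps & Z eps'].
Proof.
elim=> [|i g gi|phi psi _ [e1 [E1 p1 Z1]] _ [e2 [E2 p2 Z2]]|phi psi _ [e1 [E1 p1 Z1]] inv].
- by exists (pm_id A n); split; [exact: EA_id | exact: pm_map_id |].
- have [h [hi hg]] := mpoly_lift gi; exists (elementary i (f *: h)); split.
  + by apply: EA_elementary; apply: free_of_varZ.
  + by rewrite pm_map_elementary map_mpolyZ pif scale1r hg.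
  + exact: Z_elementary.
- exists (pm_comp e1 e2); split; [exact: EA_comp | | exact: Z_comp].
  by rewrite pm_map_comp p1 p2.
- have [e2 inv2] := EA_GA E1; exists e2; split; [exact: EA_inv inv2 | | exact: Z_inv inv2].
  by apply: pm_inverse_uniq (pm_map_inverse _ inv2) _; rewrite p1.
Qed.

End Lifting.

Section Congruence.
Variable A : comNzRingType.
Implicit Types I : A -> Prop.

Definition pm_id_mod I n (psi : polymap A n) :=
  forall i m, I (tnth psi i - 'X_i)@_m.

Lemma pm_id_modP I (Q : comNzRingType) (pi : {rmorphism A -> Q}) n (psi : polymap A n) :
  (forall x, pi x = 0 <-> I x) -> pm_map pi psi = pm_id Q n <-> pm_id_mod I psi.
Proof.
move=> ker; split=> [h i m|h].
  apply/ker; rewrite -mcoeff_map_mpoly raddfB /= map_mpoly_Xi -tnth_pm_map h tnth_pm_id.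
  by rewrite subrr mcoeff0.
apply: eq_from_tnth => i; rewrite tnth_pm_map tnth_pm_id; apply/eqP; rewrite -subr_eq0.
apply/eqP/mpolyP => m; rewrite mcoeff0; have /ker := h i m.
by rewrite -mcoeff_map_mpoly raddfB /= map_mpoly_Xi.
Qed.

Lemma EA_lift1 (Q : comNzRingType) (pi : {rmorphism A -> Q}) n (eps : polymap Q n) :
  (forall y, exists x, pi x = y) -> EA eps ->
  exists eps', EA eps' /\ pm_map pi eps' = eps.
Proof.
move=> surj he.
have [||||eps' [E' p' _]] := @EA_lift A Q pi surj 1 n (fun _ => True) (rmorph1 pi) _ _ _ _ eps he => //.
by exists eps'.
Qed.

Lemma exists_residue_field (m : A -> Prop) : is_ideal m -> ~ m 1 ->
  (forall x, ~ m x -> exists s, m (1 - x * s)) ->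
  exists (K : fieldType) (pi : {rmorphism A -> K}),
    (forall y, exists x, pi x = y) /\ (forall x, pi x = 0 <-> m x).
Proof.
move=> im m1 minv; have [Q [pi [surj ker]]] := exists_quotient im m1.
have inv (x : Q) : x != 0 -> exists y, y * x == 1.
  have [a <-] := surj x => /eqP nx.
  have [s ms] := minv a (fun ma => nx ((ker a).2 ma)).
  exists (pi s); have /ker := ms.
  by rewrite rmorphB rmorph1 rmorphM => /eqP; rewrite subr_eq0 eq_sym mulrC.
have [K [f fbij]] := exists_field inv.
exists K, (f \o pi : {rmorphism A -> K}); split=> [y|x].
  by have [g gK fK] := fbij; have [x hx] := surj (g y); exists x; rewrite /= hx fK.
rewrite -ker /=; split=> [h|->]; last exact: rmorph0.
by apply: (bij_inj fbij); rewrite h rmorph0.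
Qed.

(* Over the residue field at m, Jung-van der Kulk applies; the elementary
   factors are lifted with an element of I congruent to 1 modulo m. *)
Lemma SA2_reduce_maximal I m a (phi : polymap A 2) : is_ideal I -> is_ideal m ->
  ~ m 1 -> (forall x, ~ m x -> exists s, m (1 - x * s)) -> I a -> m (1 - a) ->
  SA phi -> (exists eps, EA eps /\ pm_id_mod I (pm_comp eps phi)) ->
  exists eps, EA eps /\ pm_id_mod (fun x => I x /\ m x) (pm_comp eps phi).
Proof.
move=> iI im m1 minv Ia ma SAphi [eps [Eeps heps]].
have [K [pi [surj ker]]] := exists_residue_field im m1 minv.
have pia : pi a = 1.
  by apply/eqP; rewrite eq_sym -subr_eq0 -(rmorph1 pi) -rmorphB; apply/eqP/ker.
have SApsi := SA_EA_comp Eeps SAphi; set psi := pm_comp eps phi in SApsi heps.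
have Epsi := SA2_field_EA (SA_map pi SApsi).
have [chi inv] := EA_GA Epsi; have Echi := EA_inv Epsi inv.
(* Quantifying over all maps that kill I includes the unit ideal, for which no nonzero quotient
   exists. *)
pose Z (e : polymap A 2) := forall (Q : comNzRingType) (rho : {rmorphism A -> Q}),
  (forall x, I x -> rho x = 0) -> pm_map rho e = pm_id Q 2.
have [|||i g gi|e [Ee pe Ze]] := @EA_lift A K pi surj a 2 Z pia _ _ _ _ chi Echi.
- by move=> Q rho _; apply: pm_map_id.
- by move=> f g Zf Zg Q rho hr; rewrite pm_map_comp Zf // Zg // pm_comp_id.
- move=> f g Zf [_ inv2] Q rho hr.
  by rewrite -[LHS]pm_comp_id -[X in pm_comp _ X](Zf Q rho hr) -pm_map_comp inv2 pm_map_id.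
- move=> Q rho hr; rewrite pm_map_elementary map_mpolyZ hr // scale0r.
  by apply: eq_from_tnth => j; rewrite tnth_elementary tnth_pm_id addr0 if_same.
exists (pm_comp e eps); split; first exact: EA_comp.
rewrite -pm_compA -/psi => i mm; split; last first.
  apply: (pm_id_modP (pi := pi) _ _).1 => //.
  by rewrite pm_map_comp pe; case: inv.
case: (classic (I 1)) => [I1|nI1].
  by rewrite -[X in I X]mulr1; have [_ _ IM] := iI; apply: IM.
have [Q [rho [_ kerr]]] := exists_quotient iI nI1.
apply: (pm_id_modP (pi := rho) _ _).1 => //.
rewrite pm_map_comp Ze; last by move=> x /kerr.
by rewrite pm_id_comp; apply/(pm_id_modP _ kerr).
Qed.

Lemma SA2_reduce_nil (phi : polymap A 2) : artinian A -> SA phi ->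
  exists I eps, [/\ is_ideal I, forall x, I x -> nilpotent_element x,
    EA eps & pm_id_mod I (pm_comp eps phi)].
Proof.
move=> hA SAphi.
pose P I := exists eps, EA eps /\ pm_id_mod I (pm_comp eps phi).
have [||I [iI PI Imin]] := @artinian_minimal A hA P (fun _ => True).
- by [].
- by exists (pm_id A 2); split; first exact: EA_id.
have nilI x : I x -> nilpotent_element x.
  move=> Ix; apply: NNPP => nx.
  have [m [e [im m1 Ie me minv]]] := artinian_maximal hA iI Ix nx.
  have [s ms] := minv e me.
  have := SA2_reduce_maximal iI im m1 minv (is_idealMr s iI Ie) ms SAphi PI.
  move=> PIm; apply: me.
  by have [|_] := Imin _ (is_ideal_inter iI im) PIm _ e Ie; first by move=> y [].
by have [eps [Eeps heps]] := PI; exists I, eps.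
Qed.

End Congruence.

(** * Ideals of square zero *)

Lemma prod_1D_square_zero (S : comNzRingType) (T : eqType) (r : seq T) (a : T -> S) :
  (forall i j, a i * a j = 0) -> \prod_(i <- r) (1 + a i) = 1 + \sum_(i <- r) a i.
Proof.
move=> a0; elim: r => [|i r IH]; first by rewrite !big_nil addr0.
rewrite !big_cons IH mulrDr mulr1 mulrDl mul1r mulr_sumr [X in _ + (_ + X)]big1 ?addr0 //.
by rewrite addrA.
Qed.

(** A permutation that moves i also moves s i, so its term has two off-diagonal factors, whose
    product is zero. *)
Lemma det_1D_square_zero (S : comNzRingType) n (N : 'M[S]_n) :
  (forall i j k l, N i j * N k l = 0) -> \det (1%:M + N) = 1 + \tr N.
Proof.
move=> N0; rewrite /determinant (bigD1 1%g) //= [X in _ + X]big1 ?addr0.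
  rewrite odd_perm1 expr0 mul1r -prod_1D_square_zero //.
  by apply: eq_bigr => i _; rewrite perm1 !mxE eqxx.
move=> s s1; have [i si] : exists i, s i != i.
  apply/existsP; apply: contraNT s1 => /existsPn h; apply/eqP/permP => i.
  by rewrite perm1; apply/eqP; rewrite -[_ == _]negbK h.
have ssi : s (s i) != s i by rewrite (inj_eq perm_inj).
rewrite (bigD1 i) //= (bigD1 (s i)) //= !mxE.
by rewrite eq_sym (negbTE si) [s i == _]eq_sym (negbTE ssi) !add0r mulrA N0 mul0r mulr0.
Qed.

Section SquareZero.
Variables (R : comNzRingType) (I : R -> Prop).
Hypothesis iI : is_ideal I.
Hypothesis I2 : forall a b, I a -> I b -> a * b = 0.

Definition coef_in n (f : {mpoly R[n]}) := forall m, I f@_m.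

Section Coef.
Variable n : nat.
Implicit Types (f g : {mpoly R[n]}).

Lemma coef_in0 : coef_in (0 : {mpoly R[n]}).
Proof. by have [I0 _ _] := iI; move=> m; rewrite mcoeff0. Qed.

Lemma coef_inD f g : coef_in f -> coef_in g -> coef_in (f + g).
Proof. by have [_ ID _] := iI; move=> hf hg m; rewrite mcoeffD; apply: ID. Qed.

Lemma coef_inZ a f : I a -> coef_in (a *: f).
Proof. by have [_ _ IM] := iI; move=> Ia m; rewrite mcoeffZ mulrC; apply: IM. Qed.

Lemma coef_in_scale a f : coef_in f -> coef_in (a *: f).
Proof. by have [_ _ IM] := iI; move=> hf m; rewrite mcoeffZ; apply: IM. Qed.

Lemma coef_inN f : coef_in f -> coef_in (- f).
Proof. by move=> hf; rewrite -scaleN1r; apply: coef_in_scale. Qed.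

Lemma coef_in_sum (T : Type) (r : seq T) (P : pred T) (F : T -> {mpoly R[n]}) :
  (forall i, P i -> coef_in (F i)) -> coef_in (\sum_(i <- r | P i) F i).
Proof. by move=> h; apply: big_ind => //; [apply: coef_in0 | apply: coef_inD]. Qed.

Lemma coef_inM f g : coef_in g -> coef_in (f * g).
Proof.
move=> hg; rewrite (mpolyE f) mulr_suml; apply: coef_in_sum => m _.
rewrite -scalerAl; apply: coef_in_scale => m'; rewrite mulrC.
case: (boolP (m <= m')%MM) => hm; last first.
  rewrite memN_msupp_eq0; first by case: iI.
  apply: contra hm; rewrite (perm_mem (msuppMX _ _)) => /mapP [m1 _ ->].
  exact: lem_addr.
by rewrite -(submK hm) addmC mcoeffMX; apply: hg.
Qed.

Lemma coef_in_mderiv f i : coef_in f -> coef_in f^`M(i).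
Proof.
have [_ _ IM] := iI; move=> hf m; rewrite mcoeff_mderiv -mulr_natl; exact: IM.
Qed.

Lemma coef_in_mul0 f g : coef_in f -> coef_in g -> f * g = 0.
Proof.
move=> hf hg; rewrite (mpolyE f) (mpolyE g) mulr_suml big1 // => m _.
rewrite mulr_sumr big1 // => m' _.
by rewrite -scalerAl -scalerAr scalerA I2 // scale0r.
Qed.

End Coef.

Lemma coef_in_comp n l (f : {mpoly R[n]}) (psi : n.-tuple {mpoly R[l]}) :
  coef_in f -> coef_in (f \mPo psi).
Proof.
move=> hf; rewrite comp_mpolyE; apply: coef_in_sum => m _.
exact: coef_inZ.
Qed.

Section Translation.
Variable n : nat.
Implicit Types (f : {mpoly R[n]}) (H G : 'I_n -> {mpoly R[n]}).

Definition translation H : polymap R n := [tuple 'X_i + H i | i < n].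

Lemma tnth_translation H i : tnth (translation H) i = 'X_i + H i.
Proof. exact: tnth_mktuple. Qed.

Lemma translation_ext H G : H =1 G -> translation H = translation G.
Proof. by move=> e; apply: eq_from_tnth => i; rewrite !tnth_translation e. Qed.

Lemma translation0 : translation (fun=> 0) = pm_id R n.
Proof. by apply: eq_from_tnth => i; rewrite tnth_translation tnth_pm_id addr0. Qed.

Lemma elementary_translation i f :
  elementary i f = translation (fun j => if j == i then f else 0).
Proof.
apply: eq_from_tnth => j; rewrite tnth_elementary tnth_translation.
by case: eqP; rewrite ?addr0.
Qed.

(** Taylor's formula ends at first order, because products of two displacements vanish. *)
Lemma comp_translation H f : (forall i, coef_in (H i)) ->
  f \mPo translation H = f + \sum_i f^`M(i) * H i.
Proof.
move=> hH; have hD g : coef_in (\sum_i g^`M(i) * H i).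
  by apply: coef_in_sum => i _; apply: coef_inM.
elim/mpoly_ring_ind: f => [c|i|p q IHp IHq|p q IHp IHq].
- by rewrite comp_mpolyC big1 ?addr0 // => i _; rewrite mderivC mul0r.
- rewrite comp_mpolyXi tnth_translation (bigD1 i) //= mderivXi eqxx mul1r.
  rewrite big1 ?addr0 // => j ji.
  by rewrite mderivXi eq_sym (negbTE ji) mul0r.
- rewrite comp_mpolyD IHp IHq addrACA -big_split /=; congr (_ + _).
  by apply: eq_bigr => i _; rewrite mderivD mulrDl.
- rewrite comp_mpolyM IHp IHq mulrDl !mulrDr (coef_in_mul0 (hD p) (hD q)) addr0 -addrA.
  congr (_ + _); rewrite mulr_suml mulr_sumr -big_split /=; apply: eq_bigr => i _.
  by rewrite mderivM; ring.
Qed.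

Lemma comp_translation_in H f : (forall i, coef_in (H i)) -> coef_in f ->
  f \mPo translation H = f.
Proof.
move=> hH hf; rewrite comp_translation // big1 ?addr0 // => i _.
by apply: coef_in_mul0 => //; apply: coef_in_mderiv.
Qed.

Lemma translation_comp H G : (forall i, coef_in (H i)) -> (forall i, coef_in (G i)) ->
  pm_comp (translation H) (translation G) = translation (fun i => G i + H i).
Proof.
move=> hH hG; apply: eq_from_tnth => i.
rewrite tnth_pm_comp !tnth_translation comp_mpolyD comp_mpolyXi tnth_translation.
by rewrite comp_translation_in // addrA.
Qed.

Lemma det_jacobian_translation H : (forall i, coef_in (H i)) ->
  \det (jacobian (translation H)) = 1 + \sum_i (H i)^`M(i).
Proof.
move=> hH; pose N : 'M[{mpoly R[n]}]_n := \matrix_(i, j) (H i)^`M(j).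
have -> : jacobian (translation H) = 1%:M + N.
  by apply/matrixP => i j; rewrite !mxE tnth_translation mderivD mderivXi.
rewrite det_1D_square_zero /mxtrace; last first.
  by move=> i j k l; rewrite !mxE; apply: coef_in_mul0; apply: coef_in_mderiv.
by congr (_ + _); apply: eq_bigr => i _; rewrite !mxE.
Qed.

Definition tame_field H := (forall i, coef_in (H i)) /\ EA (translation H).

Lemma tame_field_ext H G : H =1 G -> tame_field H -> tame_field G.
Proof.
by move=> e [h1 h2]; split=> [i|]; rewrite -?e // -(translation_ext e).
Qed.

Lemma tame_field0 : tame_field (fun=> 0).
Proof. by split=> [i|]; [apply: coef_in0 | rewrite translation0; apply: EA_id]. Qed.

Lemma tame_fieldD H G : tame_field H -> tame_field G -> tame_field (fun i => H i + G i).
Proof.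
move=> [h1 h2] [g1 g2]; split=> [i|]; first exact: coef_inD.
by rewrite -translation_comp //; apply: EA_comp.
Qed.

Lemma tame_field_sum (T : Type) (r : seq T) (P : pred T) (F : T -> 'I_n -> {mpoly R[n]}) :
  (forall t, P t -> tame_field (F t)) ->
  tame_field (fun i => \sum_(t <- r | P t) F t i).
Proof.
move=> hF; elim: r => [|t r IH].
  by apply: tame_field_ext tame_field0 => i; rewrite big_nil.
case Pt : (P t); last by apply: tame_field_ext IH => i; rewrite big_cons Pt.
apply: tame_field_ext (tame_fieldD (hF t Pt) IH) => i.
by rewrite big_cons Pt.
Qed.

Lemma tame_field_elementary i f : free_of_var i f -> coef_in f ->
  tame_field (fun j => if j == i then f else 0).
Proof.
move=> fi hf; split=> [j|]; first by case: eqP => _ //; apply: coef_in0.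
by rewrite -elementary_translation; apply: EA_elementary.
Qed.

End Translation.
End SquareZero.

Lemma exprDn_split2 (S : comNzRingType) (x y : S) t :
  (x + y) ^+ t.+2 = x ^+ t.+2 + (x ^+ t.+1 * y *+ t.+2
    + \sum_(i < t.+1) x ^+ (t - i) * y ^+ i.+2 *+ 'C(t.+2, i.+2)).
Proof.
rewrite exprDn big_ord_recl big_ord_recl expr0 mulr1 subn0 bin0 mulr1n.
by rewrite lift0 subn1 expr1 bin1.
Qed.

(** * Hamiltonian fields of the plane over a Q-algebra *)

Section RationalPlane.
Variables (R : comNzRingType) (I : R -> Prop).
Hypothesis iI : is_ideal I.
Hypothesis I2 : forall a b, I a -> I b -> a * b = 0.
Hypothesis hQ : Q_algebra R.
Local Notation R2 := {mpoly R[2]}.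

Lemma natr_inverse n : exists u : R, u * n.+1%:R = 1.
Proof.
have [f] := hQ; exists (f n.+1%:R^-1).
by rewrite -(rmorph_nat f) -rmorphM mulVf ?rmorph1 // Num.Theory.pnatr_eq0.
Qed.

Lemma free_of_mderiv0 (i : 'I_2) (f : R2) : f^`M(i) = 0 -> free_of_var i f.
Proof.
move=> fi0; apply: free_of_varE => m mi.
have [u hu] := natr_inverse (m i).-1.
have le : (U_(i) <= m)%MM by rewrite lep1mP.
have := mcoeff_mderiv i f (m - U_(i))%MM; rewrite fi0 mcoeff0 submK // => h.
have e : ((m - U_(i))%MM i).+1 = (m i).-1.+1.
  by rewrite mnmBE mnm1E eqxx subn1.
by rewrite -(mul1r f@_m) -hu mulrAC -mulrA mulr_natr -e -h mulr0.
Qed.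

Definition hamiltonian (h : R2) (i : 'I_2) : R2 :=
  if i == i0 then h^`M(i1) else - h^`M(i0).

Definition tame_hamiltonian (h : R2) :=
  coef_in I h /\ tame_field I (hamiltonian h).

Lemma tame_hamiltonianD h g :
  tame_hamiltonian h -> tame_hamiltonian g -> tame_hamiltonian (h + g).
Proof.
move=> [ch th] [cg tg]; split; first exact: coef_inD.
apply: tame_field_ext (tame_fieldD iI I2 th tg) => i.
by rewrite /hamiltonian !mderivD; case: eqP; rewrite ?opprD.
Qed.

Lemma tame_hamiltonian0 : tame_hamiltonian 0.
Proof.
split; first exact: coef_in0.
apply: tame_field_ext (tame_field0 iI 2) => i.
by rewrite /hamiltonian !mderiv0 oppr0 if_same.
Qed.

Lemma tame_hamiltonian_sum (T : Type) (r : seq T) (P : pred T) (F : T -> R2) :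
  (forall t, P t -> tame_hamiltonian (F t)) -> tame_hamiltonian (\sum_(t <- r | P t) F t).
Proof.
by move=> h; apply: big_ind => //; [apply: tame_hamiltonian0 | apply: tame_hamiltonianD].
Qed.

Lemma free_of_var_mderiv (i j : 'I_2) (f : R2) :
  free_of_var i f -> free_of_var i f^`M(j).
Proof.
move=> fi; apply: free_of_varE => m mi; rewrite mcoeff_mderiv.
rewrite (free_of_var_coef fi) ?mul0rn //.
by rewrite mnmDE addn_eq0 negb_and mi.
Qed.

Lemma tame_hamiltonian_free0 h : coef_in I h -> free_of_var i0 h -> tame_hamiltonian h.
Proof.
move=> ch fh; split => //.
have := tame_field_elementary iI (free_of_var_mderiv (j := i1) fh) (coef_in_mderiv iI i1 ch).
by apply: tame_field_ext => i; rewrite /hamiltonian (mderiv_free fh) oppr0.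
Qed.

Lemma tame_hamiltonian_free1 h : coef_in I h -> free_of_var i1 h -> tame_hamiltonian h.
Proof.
move=> ch fh; split => //.
have ch0 : coef_in I (- h^`M(i0)) by apply: coef_inN => //; apply: coef_in_mderiv.
have := tame_field_elementary iI (free_of_varN (free_of_var_mderiv (j := i0) fh)) ch0.
apply: tame_field_ext => i; rewrite /hamiltonian (mderiv_free fh).
by case: (ord2P i) => ->.
Qed.

Lemma mderivXn (f : R2) i t : (f ^+ t.+1)^`M(i) = f ^+ t * f^`M(i) *+ t.+1.
Proof.
elim: t => [|t IH]; first by rewrite expr1 expr0 mul1r mulr1n.
by rewrite exprS mderivM IH exprS; ring.
Qed.

(* Conjugating the flow of a y ^ t by (x, y + x ^ s). *)
Lemma tame_hamiltonian_shear a s t : I a ->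
  tame_hamiltonian (a *: ('X_i1 + 'X_i0 ^+ s) ^+ t).
Proof.
move=> Ia; case: t => [|t].
  rewrite expr0; apply: tame_hamiltonian_free0; first exact: coef_inZ.
  by apply: free_of_varZ; rewrite -mpolyC1; apply: free_of_varC.
pose g : R2 := 'X_i0 ^+ s; pose h : R2 := a *: 'X_i1 ^+ t.+1.
have fg : free_of_var i1 g.
  by rewrite /g mpolyXn; apply: free_of_varX; rewrite mulmnE mnm1E.
have fh : free_of_var i0 h.
  by rewrite /h mpolyXn; apply/free_of_varZ/free_of_varX; rewrite mulmnE mnm1E.
have ch : coef_in I h by apply: coef_inZ.
have [_ [_ Eh]] := tame_hamiltonian_free0 ch fh.
have Eg : EA (elementary i1 g) by apply: EA_elementary.
have Eg' : EA (elementary i1 (- g)) by apply: EA_elementary; apply: free_of_varN.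
have := EA_comp Eg' (EA_comp Eh Eg).
set h' := a *: _; have ch' : coef_in I h' by apply: coef_inZ.
have hmil i : coef_in I (hamiltonian h' i).
  rewrite /hamiltonian; case: eqP => _; first exact: coef_in_mderiv.
  by apply: coef_inN => //; apply: coef_in_mderiv.
suff -> : pm_comp (elementary i1 (- g)) (pm_comp (translation (hamiltonian h)) (elementary i1 g))
   = translation (hamiltonian h') by move=> E'; split.
have e1 : (h^`M(i1)) \mPo elementary i1 g = h'^`M(i1).
  rewrite /h /h' !mderivZ !mderivXn mderivD !mderivXi (mderiv_free fg) /= addr0 !mulr1.
  by rewrite comp_mpolyZ rmorphMn rmorphXn /= comp_mpolyXi tnth_elementary eqxx.
have e0 : h'^`M(i0) = h'^`M(i1) * g^`M(i0).
  rewrite /h' !mderivZ !mderivXn !mderivD !mderivXi /= (mderiv_free fg) add0r addr0 mulr1.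
  by rewrite -scalerAl mulrnAl.
have etr : pm_comp (translation (hamiltonian h)) (elementary i1 g)
   = pm2 ('X_i0 + h'^`M(i1)) ('X_i1 + g).
  rewrite [LHS]pm2_eta !tnth_pm_comp !tnth_translation /hamiltonian /=.
  rewrite (mderiv_free fh) oppr0 addr0 comp_mpolyD e1 !comp_mpolyXi !tnth_elementary /=.
  by [].
rewrite etr elementary1_comp [RHS]pm2_eta !tnth_translation /hamiltonian /=; congr pm2.
rewrite comp_mpolyN -(comp_translation_in iI I2 (H := hamiltonian h') hmil (coef_in_mderiv iI i0 ch')).
(* As g is free of y, the second component may be altered so that the map becomes a translation with
   coefficients in I. *)
have -> : g \mPo pm2 ('X_i0 + h'^`M(i1)) ('X_i1 + g) = g \mPo translation (hamiltonian h').
  apply: comp_free_of_var fg _ => j; rewrite tnth_pm2 tnth_translation /hamiltonian.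
  by case: (ord2P j) => -> //=.
rewrite (comp_translation iI I2 _ hmil) (comp_translation_in iI I2 hmil (coef_in_mderiv iI i0 ch')).
rewrite !big_ord_recl big_ord0 /hamiltonian /= (mderiv_free fg) mul0r !addr0 e0.
by ring.
Qed.

Lemma tame_hamiltonian_monomial a s t : I a ->
  tame_hamiltonian (a *: ('X_i0 ^+ s * 'X_i1 ^+ t)).
Proof.
have [n] := ubnP t; elim: n t a s => // n IH [|t] a s; rewrite ltnS => tn Ia.
  apply: tame_hamiltonian_free1; first exact: coef_inZ.
  rewrite expr0 mulr1 mpolyXn; apply/free_of_varZ/free_of_varX.
  by rewrite mulmnE mnm1E.
(* Here b = a / (t + 2), so the term of b (y + x^s)^(t+2) linear in x^s is a x^s y^(t+1). The others
   are a pure power of y and terms of lower degree in y. *)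
have [u hu] := natr_inverse t.+1; pose b := a * u.
have Ib : I b by apply: is_idealMr.
have Ib' c : I (- b * c).
  by apply: is_idealMr => //; rewrite -mulN1r; case: iI => _ _; apply.
have -> : a *: ('X_i0 ^+ s * 'X_i1 ^+ t.+1)
    = b *: ('X_i1 + 'X_i0 ^+ s) ^+ t.+2 + ((- b * 1) *: 'X_i1 ^+ t.+2
      + \sum_(i < t.+1) (- b * 'C(t.+2, i.+2)%:R) *: ('X_i0 ^+ (s * i.+2) * 'X_i1 ^+ (t - i))) :> R2.
  have split_sum (W V X Y Y' : R2) : b *: X = W -> b *: Y + Y' = 0 ->
      W = b *: (V + (X + Y)) + ((- b * 1) *: V + Y').
    move=> <- hY.
    by rewrite !scalerDr mulr1 scaleNr addrACA subrr add0r -addrA hY addr0.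
  rewrite exprDn_split2; apply: split_sum.
    by rewrite -scaler_nat scalerA /b -mulrA hu mulr1 mulrC.
  rewrite scaler_sumr -big_split /= big1 // => i _.
  rewrite -exprM mulNr scaleNr -scalerA scaler_nat.
  by rewrite [X in b *: (X *+ _) - _]mulrC subrr.
apply: tame_hamiltonianD; first exact: tame_hamiltonian_shear.
apply: tame_hamiltonianD.
  apply: tame_hamiltonian_free0; first exact: coef_inZ.
  by rewrite mpolyXn; apply/free_of_varZ/free_of_varX; rewrite mulmnE mnm1E.
apply: tame_hamiltonian_sum => i _; apply: IH => //.
by apply: leq_ltn_trans tn; apply: leq_subr.
Qed.

Lemma mono2E (m : 'X_{1..2}) : 'X_[m] = 'X_i0 ^+ m i0 * 'X_i1 ^+ m i1 :> R2.
Proof. by rewrite mpolyXE_id !big_ord_recl big_ord0 mulr1. Qed.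

Lemma tame_hamiltonian_all h : coef_in I h -> tame_hamiltonian h.
Proof.
move=> ch; rewrite (mpolyE h); apply: tame_hamiltonian_sum => m _.
by rewrite mono2E; apply: tame_hamiltonian_monomial.
Qed.

Lemma exists_primitive (f : R2) : coef_in I f ->
  exists h, coef_in I h /\ h^`M(i1) = f.
Proof.
move=> cf; have inv n : exists u : R, u * n.+1%:R == 1.
  by have [u /eqP hu] := natr_inverse n; exists u.
pose u n := xchoose (inv n); have uP n : u n * n.+1%:R = 1 by apply/eqP/(xchooseP (inv n)).
exists (\sum_(m <- msupp f) (f@_m * u (m i1)) *: 'X_[m + U_(i1)]); split.
  apply: coef_in_sum => // m _; apply: coef_inZ => //; exact: is_idealMr.
rewrite raddf_sum /= [RHS]mpolyE; apply: eq_bigr => m _.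
rewrite mderivZ mderivX scalerA mnmDE mnm1E eqxx addn1 -mulrA uP mulr1.
by congr (_ *: 'X_[_]); rewrite addmK.
Qed.

(** If h is a primitive of [V i0] in y, then w = V i1 + dh/dx has dw/dy = div V = 0. So V is the
    field of h plus an elementary field. *)
Lemma tame_field_plane (V : 'I_2 -> R2) : (forall i, coef_in I (V i)) ->
  \sum_i (V i)^`M(i) = 0 -> EA (translation V).
Proof.
move=> cV; rewrite !big_ord_recl big_ord0 addr0 => div0.
have [h [ch hy]] := exists_primitive (cV i0).
pose w := V i1 + h^`M(i0).
have cw : coef_in I w by apply: coef_inD => //; apply: coef_in_mderiv.
have fw : free_of_var i1 w.
  apply: free_of_mderiv0; rewrite /w mderivD mderiv_comm hy addrC; exact: div0.
have [_ th] := tame_hamiltonian_all ch.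
have [_] := tame_fieldD iI I2 th (tame_field_elementary iI fw cw).
congr (EA _); apply: translation_ext => i; rewrite /hamiltonian.
case: (ord2P i) => -> /=; first by rewrite hy addr0.
by rewrite /w; ring.
Qed.

End RationalPlane.

(** * Adding variables *)

Section Extension.
Variable R : comNzRingType.

Section OneExtension.
Variables (n N : nat) (le_nN : (n <= N)%N).

Definition widen_vars : n.-tuple {mpoly R[N]} := [tuple 'X_(widen_ord le_nN k) | k < n].

(** Indexing by n <= N rather than by [n + m] lets extensions be iterated without casts. *)
Definition extend (phi : polymap R n) : polymap R N :=
  [tuple if insub (val i) is Some j then tnth phi j \mPo widen_vars else 'X_i | i < N].

Lemma ord_widenP (i : 'I_N) : (exists j, i = widen_ord le_nN j) \/ (n <= i)%N.
Proof.
case: (ltnP i n) => h; [left | by right].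
by exists (Ordinal h); apply: val_inj.
Qed.

Lemma tnth_extend_widen phi j :
  tnth (extend phi) (widen_ord le_nN j) = tnth phi j \mPo widen_vars.
Proof. by rewrite tnth_mktuple /= valK. Qed.

Lemma tnth_extend_geq phi (i : 'I_N) : (n <= i)%N -> tnth (extend phi) i = 'X_i.
Proof. by move=> h; rewrite tnth_mktuple insubN // -leqNgt. Qed.

Lemma widen_vars_extend f (phi : polymap R n) :
  (f \mPo widen_vars) \mPo extend phi = (f \mPo phi) \mPo widen_vars.
Proof.
rewrite !comp_mpolyA; congr (_ \mPo _); apply: eq_from_tnth => j.
by rewrite !tnth_mktuple comp_mpolyXi tnth_extend_widen.
Qed.

Lemma extend_id : extend (pm_id R n) = pm_id R N.
Proof.
apply: eq_from_tnth => i; rewrite tnth_pm_id.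
have [[j ->]|h] := ord_widenP i; last by rewrite tnth_extend_geq.
by rewrite tnth_extend_widen tnth_pm_id comp_mpolyXi tnth_mktuple.
Qed.

Lemma extend_comp (phi psi : polymap R n) :
  extend (pm_comp phi psi) = pm_comp (extend phi) (extend psi).
Proof.
apply: eq_from_tnth => i; rewrite tnth_pm_comp.
have [[j ->]|h] := ord_widenP i; last by rewrite !tnth_extend_geq // comp_mpolyXi tnth_extend_geq.
by rewrite !tnth_extend_widen tnth_pm_comp widen_vars_extend.
Qed.

Lemma extend_inverse (phi psi : polymap R n) :
  pm_inverse phi psi -> pm_inverse (extend phi) (extend psi).
Proof. by case=> h1 h2; split; rewrite -extend_comp ?h1 ?h2 extend_id. Qed.

Lemma widen_ord_inj : injective (widen_ord le_nN).
Proof. by move=> i j /(congr1 val) /= h; apply: val_inj. Qed.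

Lemma widen_mono (m : 'X_{1..n}) :
  exists m' : 'X_{1..N}, 'X_[m] \mPo widen_vars = 'X_[m'] /\
    (forall j, m' (widen_ord le_nN j) = m j) /\ (forall i : 'I_N, (n <= i)%N -> m' i = 0%N).
Proof.
exists [multinom if insub (val i) is Some j then m j else 0%N | i < N]; split.
  rewrite comp_mpolyX [RHS]mpolyXE_id.
  rewrite (bigID (fun i : 'I_N => (i < n)%N)) /= [X in _ = _ * X]big1 ?mulr1; last first.
    by move=> i hi; rewrite mnmE insubN // expr0.
  rewrite (big_ord_narrow le_nN) /=; apply: eq_bigr => j _.
  by rewrite mnmE /= valK tnth_mktuple.
by split=> [j|i hi]; rewrite mnmE /= ?valK // insubN // -leqNgt.
Qed.

Lemma free_of_var_widen i (f : {mpoly R[n]}) :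
  free_of_var i f -> free_of_var (widen_ord le_nN i) (f \mPo widen_vars).
Proof.
move=> fi; rewrite comp_mpolyEX big_seq.
apply: (big_ind (fun h => free_of_var (widen_ord le_nN i) h)) => [|h h'|m hm].
- by rewrite -mpolyC0; apply: free_of_varC.
- exact: free_of_varD.
- have [m' [-> [h _]]] := widen_mono m.
  by apply/free_of_varZ/free_of_varX; rewrite h fi.
Qed.

Lemma free_of_var_geq (i : 'I_N) (f : {mpoly R[n]}) :
  (n <= i)%N -> free_of_var i (f \mPo widen_vars).
Proof.
move=> hi; rewrite comp_mpolyEX.
apply: (big_ind (fun h => free_of_var i h)) => [|h h'|m _].
- by rewrite -mpolyC0; apply: free_of_varC.
- exact: free_of_varD.
- have [m' [-> [_ h]]] := widen_mono m.
  by apply/free_of_varZ/free_of_varX; rewrite h.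
Qed.

Lemma extend_elementary i (f : {mpoly R[n]}) :
  extend (elementary i f) = elementary (widen_ord le_nN i) (f \mPo widen_vars).
Proof.
apply: eq_from_tnth => l; rewrite tnth_elementary.
have [[j ->]|h] := ord_widenP l.
  rewrite tnth_extend_widen tnth_elementary (inj_eq widen_ord_inj).
  by case: eqP => _; rewrite ?comp_mpolyD comp_mpolyXi tnth_mktuple.
rewrite tnth_extend_geq //; case: eqP => // e; move: h; rewrite e /=.
by rewrite leqNgt ltn_ord.
Qed.

Lemma EA_extend (phi : polymap R n) : EA phi -> EA (extend phi).
Proof.
elim=> [|i f fi|f g _ hf _ hg|f g _ hf inv].
- by rewrite extend_id; apply: EA_id.
- by rewrite extend_elementary; apply: EA_elementary; apply: free_of_var_widen.
- by rewrite extend_comp; apply: EA_comp.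
- by apply: EA_inv hf (extend_inverse inv).
Qed.

Lemma mderiv_widen f j :
  (f \mPo widen_vars)^`M(widen_ord le_nN j) = f^`M(j) \mPo widen_vars.
Proof.
rewrite mderiv_comp (bigD1 j) //= tnth_mktuple mderivXi eqxx mulr1 big1 ?addr0 //.
move=> i ij; rewrite tnth_mktuple mderivXi (inj_eq widen_ord_inj) (negbTE ij).
by rewrite mulr0.
Qed.

End OneExtension.

Lemma extend_trans n m N (h1 : (n <= m)%N) (h2 : (m <= N)%N) (h3 : (n <= N)%N)
    (phi : polymap R n) : extend h2 (extend h1 phi) = extend h3 phi.
Proof.
have hw f : (f \mPo widen_vars h1) \mPo widen_vars h2 = f \mPo widen_vars h3.
  rewrite comp_mpolyA; congr (_ \mPo _); apply: eq_from_tnth => j.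
  rewrite !tnth_mktuple comp_mpolyXi tnth_mktuple; congr 'X__.
  exact: val_inj.
apply: eq_from_tnth => i; have [[j ->]|hi] := ord_widenP h3 i; last first.
  rewrite (tnth_extend_geq h3) //.
  have [[l e]|hi'] := ord_widenP h2 i; last by rewrite (tnth_extend_geq h2).
  rewrite e tnth_extend_widen tnth_extend_geq ?comp_mpolyXi ?tnth_mktuple //.
  by move: hi; rewrite e.
rewrite tnth_extend_widen.
have -> : widen_ord h3 j = widen_ord h2 (widen_ord h1 j) by apply: val_inj.
by rewrite !tnth_extend_widen hw.
Qed.

Lemma stabilize_extend m n (phi : polymap R n) :
  stabilize m phi = extend (leq_addr m n) phi.
Proof.
have hs (j : 'I_n) : lshift m j = widen_ord (leq_addr m n) j by apply: val_inj.
have hv : [tuple 'X_(lshift m k) | k < n] = widen_vars (leq_addr m n).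
  by apply: eq_from_tnth => j; rewrite !tnth_mktuple hs.
apply: eq_from_tnth => i; rewrite tnth_mktuple; case: splitP => [j e|j e].
  have -> : i = widen_ord (leq_addr m n) j by apply: val_inj.
  by rewrite tnth_extend_widen hv.
by rewrite tnth_extend_geq // e leq_addr.
Qed.

Lemma extend_self n (h : (n <= n)%N) (phi : polymap R n) : extend h phi = phi.
Proof.
apply: eq_from_tnth => i; have hw j : widen_ord h j = j by apply: val_inj.
rewrite -{1}(hw i) tnth_extend_widen.
have -> : widen_vars h = pm_id R n by apply: eq_from_tnth => j; rewrite !tnth_mktuple hw.
exact: comp_mpoly_id.
Qed.

Lemma det_jacobian_extendS n (phi : polymap R n) :
  \det (jacobian (extend (leqnSn n) phi)) =
    \det (jacobian phi) \mPo widen_vars (leqnSn n).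
Proof.
rewrite (expand_det_row _ ord_max) (bigD1 ord_max) //= [X in _ + X]big1 ?addr0.
  rewrite mxE tnth_extend_geq ?leqnn // mderivXi eqxx mul1r /cofactor.
  rewrite addnn -signr_odd odd_double expr0 mul1r -det_map_mx; congr (\det _).
  have lw (i : 'I_n) : lift ord_max i = widen_ord (leqnSn n) i.
    by apply: val_inj; rewrite /= /bump leqNgt ltn_ord.
  by apply/matrixP => i j; rewrite !mxE !lw tnth_extend_widen mderiv_widen.
move=> j hj; rewrite mxE tnth_extend_geq ?leqnn // mderivXi eq_sym (negbTE hj).
by rewrite mul0r.
Qed.

Lemma det_jacobian_extend n N (h : (n <= N)%N) (phi : polymap R n) :
  \det (jacobian phi) = 1 -> \det (jacobian (extend h phi)) = 1.
Proof.
elim: N h => [|N IH] h hphi.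
  by move: phi hphi; case: n h => // h phi; rewrite extend_self.
have /orP[/eqP e|] : (n == N.+1) || (n < N.+1)%N by rewrite -leq_eqVlt.
  by clear IH; subst n; rewrite extend_self.
rewrite ltnS => h'; rewrite -(extend_trans h' (leqnSn N)) det_jacobian_extendS IH //.
by rewrite comp_mpoly1.
Qed.

End Extension.

Lemma pm_map_extend (A Q : comNzRingType) (pi : {rmorphism A -> Q}) n N (h : (n <= N)%N)
    (phi : polymap A n) : pm_map pi (extend h phi) = extend h (pm_map pi phi).
Proof.
apply: eq_from_tnth => i; rewrite tnth_pm_map.
have [[j ->]|hi] := ord_widenP h i; last by rewrite !tnth_extend_geq // map_mpoly_Xi.
rewrite !tnth_extend_widen map_mpoly_mPo tnth_pm_map; congr (_ \mPo _).
by apply: eq_from_tnth => l; rewrite !tnth_mktuple map_mpoly_Xi.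
Qed.

(** * Divergence-free fields with one more variable *)

Section StableSquareZero.
Variables (R : comNzRingType) (I : R -> Prop).
Hypothesis iI : is_ideal I.
Hypothesis I2 : forall a b, I a -> I b -> a * b = 0.
Variable n : nat.
Local Notation z := (ord_max : 'I_n.+1).
Local Notation w := (widen_ord (leqnSn n)).
Local Notation up := (fun f : {mpoly R[n]} => f \mPo widen_vars R (leqnSn n)).

Lemma widen_neq_max (i : 'I_n) : (w i == z) = false.
Proof. by apply/eqP => /(congr1 val) /= h; have := ltn_ord i; rewrite h ltnn. Qed.

Definition commutator_field a (i : 'I_n) (g : {mpoly R[n]}) (l : 'I_n.+1) : {mpoly R[n.+1]} :=
  if l == w i then - (a *: up g)
  else if l == z then a *: ('X_z * up g^`M(i)) else 0.

(* Up to elementary factors, this is the commutator of x_i + a z and z + g. *)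
Lemma tame_commutator a i g : I a -> tame_field I (commutator_field a i g).
Proof.
move=> Ia; pose gz := up g; pose gi := up g^`M(i).
have fgz f : free_of_var z (up f) by apply: free_of_var_geq.
have fX : free_of_var (w i) (a *: 'X_z : {mpoly R[n.+1]}).
  by apply/free_of_varZ/free_of_varX; rewrite mnm1E eq_sym widen_neq_max.
have Eg : EA (elementary z gz) by exact: (EA_elementary (fgz g)).
have Eg' : EA (elementary z (- gz)) by exact: (EA_elementary (free_of_varN (fgz g))).
have E1 : EA (elementary (w i) (a *: 'X_z)) by apply: EA_elementary.
pose P := a *: ('X_z - gz).
have cP : coef_in I P by apply: coef_inZ.
pose HP (l : 'I_n.+1) := if l == w i then P else 0.
pose HC (l : 'I_n.+1) := if l == w i then P else if l == z then gi * P else 0.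
have cHP l : coef_in I (HP l) by rewrite /HP; case: eqP => _ //; apply: coef_in0.
have cHC l : coef_in I (HC l).
  rewrite /HC; case: eqP => _ //; case: eqP => _; last exact: coef_in0.
  exact: coef_inM.
pose inner := pm_comp (elementary (w i) (a *: 'X_z)) (elementary z (- gz)).
have inner_z : tnth inner z = 'X_z - gz.
  by rewrite tnth_pm_comp tnth_elementary eq_sym widen_neq_max comp_mpolyXi tnth_elementary eqxx.
have inner_other l : l != z -> tnth inner l = 'X_l + HP l.
  move=> lz; rewrite tnth_pm_comp tnth_elementary /HP; case: eqP => [e|_].
    rewrite comp_mpolyD comp_mpolyZ !comp_mpolyXi !tnth_elementary eqxx (negbTE lz).
    by [].
  by rewrite comp_mpolyXi tnth_elementary (negbTE lz) addr0.
have gz_inner : gz \mPo inner = gz + gi * P.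
  rewrite (comp_free_of_var (l' := translation HP) (fgz g)); last first.
    by move=> l lz; rewrite inner_other // tnth_translation.
  rewrite (comp_translation iI I2 _ cHP) (bigD1 (w i)) //= /HP eqxx mderiv_widen.
  by rewrite big1 ?addr0 // => l /negbTE ->; rewrite mulr0.
have EC : EA (translation HC).
  have := EA_comp Eg (EA_comp E1 Eg'); rewrite -/inner; congr (EA _).
  apply: eq_from_tnth => l; rewrite tnth_pm_comp tnth_elementary tnth_translation /HC.
  case: (eqVneq l z) => [->|lz].
    rewrite eq_sym widen_neq_max comp_mpolyD comp_mpolyXi inner_z gz_inner.
    by ring.
  by rewrite comp_mpolyXi inner_other // /HP; case: eqP.
have cX : coef_in I (- (a *: 'X_z) : {mpoly R[n.+1]}).
  by apply: coef_inN => //; apply: coef_inZ.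
have cgg : coef_in I (up (a *: (g^`M(i) * g))).
  by apply: coef_in_comp => //; apply: coef_inZ.
(* The two elementary fields correct a (z - g) to - a g in direction x_i, and a (dg/dx_i) (z - g) to
   a z (dg/dx_i) in direction z. *)
have := tame_fieldD iI I2 (tame_fieldD iI I2 (conj cHC EC)
  (tame_field_elementary iI (free_of_varN fX) cX))
  (tame_field_elementary iI (fgz (a *: (g^`M(i) * g))) cgg).
apply: tame_field_ext => l; rewrite /commutator_field /HC.
case: (eqVneq l (w i)) => [->|lw].
  by rewrite widen_neq_max addr0 /P scalerBr addrAC subrr add0r.
case: (eqVneq l z) => [_|lz]; last by rewrite !addr0.
rewrite addr0 comp_mpolyZ comp_mpolyM /P -/gi -/gz -scalerAr -scalerDr; congr (_ *: _).
by ring.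
Qed.

(** Summed over the monomials of all [V i], the commutator fields give V in the old variables and -
    z div V = 0 in direction z. *)
Lemma EA_extend_translation (V : 'I_n -> {mpoly R[n]}) :
  (forall i, coef_in I (V i)) -> \sum_i (V i)^`M(i) = 0 ->
  EA (extend (leqnSn n) (translation V)).
Proof.
move=> cV div0.
have [_] : tame_field I (fun l => \sum_i \sum_(m <- msupp (V i))
    commutator_field (- (V i)@_m) i 'X_[m] l).
  apply: tame_field_sum => // i _; apply: tame_field_sum => // m _.
  by apply: tame_commutator; rewrite -mulN1r; case: iI => _ _; apply; apply: cV.
congr (EA _); apply: eq_from_tnth => l; rewrite tnth_translation.
have [[j ->]|hl] := ord_widenP (leqnSn n) l.
  rewrite tnth_extend_widen tnth_translation comp_mpolyD comp_mpolyXi tnth_mktuple.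
  congr (_ + _); rewrite (bigD1 j) //= [X in _ + X]big1 ?addr0.
    rewrite [in RHS](mpolyE (V j)) raddf_sum; apply: eq_bigr => m _.
    by rewrite /commutator_field eqxx scaleNr opprK /= comp_mpolyZ.
  move=> i ij; apply: big1 => m _; rewrite /commutator_field widen_neq_max.
  by rewrite (inj_eq (@widen_ord_inj _ _ (leqnSn n))) eq_sym (negbTE ij).
have -> : l = z by apply: val_inj; apply/eqP; rewrite /= eqn_leq hl -ltnS ltn_ord.
rewrite tnth_extend_geq ?leqnn // -[RHS]addr0; congr (_ + _).
transitivity (- ('X_z * up (\sum_i (V i)^`M(i)))); last first.
  by rewrite div0 comp_mpoly0 mulr0 oppr0.
rewrite raddf_sum /= mulr_sumr -sumrN; apply: eq_bigr => i _.
have -> : up (V i)^`M(i) = \sum_(m <- msupp (V i)) (V i)@_m *: up ('X_[m])^`M(i).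
  have dV : (V i)^`M(i) = \sum_(m <- msupp (V i)) ((V i)@_m *: 'X_[m])^`M(i).
    by rewrite [in LHS](mpolyE (V i)); apply: raddf_sum.
  transitivity (\sum_(m <- msupp (V i)) up ((V i)@_m *: 'X_[m])^`M(i)).
    by rewrite dV; apply: raddf_sum.
  by apply: eq_bigr => m _; rewrite mderivZ comp_mpolyZ.
rewrite mulr_sumr -sumrN; apply: eq_bigr => m _.
by rewrite /commutator_field eq_sym widen_neq_max eqxx -scalerAr scaleNr.
Qed.

End StableSquareZero.

(** * Descent along squares of ideals *)

Section IdealSquare.
Variable A : comNzRingType.
Implicit Types I J : A -> Prop.

(** The ideal generated by the products, encoded so that a membership is used by naming a suitable
    J. *)
Definition ideal_square I (x : A) : Prop :=
  forall J, is_ideal J -> (forall a b, I a -> I b -> J (a * b)) -> J x.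

Lemma is_ideal_square I : is_ideal (ideal_square I).
Proof.
split=> [J [J0 _ _] _ //|x y sx sy J iJ hJ|a x sx J iJ hJ].
  by have [_ JD _] := iJ; apply: JD; [apply: sx | apply: sy].
by have [_ _ JM] := iJ; apply: JM; apply: sx.
Qed.

Lemma ideal_square_mul I a b : I a -> I b -> ideal_square I (a * b).
Proof. by move=> Ia Ib J _; apply. Qed.

Lemma ideal_square_sub I x : is_ideal I -> ideal_square I x -> I x.
Proof. by move=> iI; apply => // a b _ Ib; case: iI => _ _; apply. Qed.

(** Take K minimal with K I nonzero, and a in K with a I nonzero. As I is its own square, (a I) I is
    nonzero, so a lies in a I by minimality. Then a = a y with y nilpotent, so a = 0. *)
Lemma artinian_nil_idempotent I : artinian A -> is_ideal I ->
  (forall x, I x -> nilpotent_element x) -> (forall x, I x -> ideal_square I x) ->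
  forall x, I x -> x = 0.
Proof.
move=> hA iI nilI sqI x0 Ix0; apply: NNPP => nx0.
pose P (K : A -> Prop) := exists a b, [/\ K a, I b & a * b <> 0].
have [||K [iK [a [b [Ka Ib ab]]] Kmin]] := @artinian_minimal A hA P (fun _ => True).
- by [].
- by exists 1, x0; rewrite mul1r.
have subK x : principal a x -> K x by move=> [r ->]; apply: is_idealMr.
pose K2 x := exists y, I y /\ x = a * y.
have iK2 : is_ideal K2.
  have [I0 ID IM] := iI; split=> [|_ _ [u [Iu ->]] [v [Iv ->]]|r _ [u [Iu ->]]].
  - by exists 0; rewrite mulr0.
  - by exists (u + v); rewrite mulrDr; split => //; apply: ID.
  - by exists (r * u); rewrite mulrCA; split => //; apply: IM.
have PK2 : P K2.
  apply: NNPP => nP; apply: ab.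
  (* J is the annihilator of a: it would contain all products of elements of I, hence b. *)
  apply: (sqI b Ib (fun r => a * r = 0)).
    split=> [|u v hu hv|u v hv]; first exact: mulr0.
      by rewrite mulrDr hu hv addr0.
    by rewrite mulrCA hv mulr0.
  move=> u v Iu Iv; apply: NNPP => h; apply: nP; exists (a * u), v.
  by split => //; [exists u | rewrite -mulrA].
have [|y [Iy ay]] := Kmin K2 iK2 PK2 _ a Ka.
  by move=> _ [y [_ ->]]; apply: subK; exists y.
have [u hu] := nilpotent_unit (nilI y Iy).
by apply: ab; rewrite -[a]mulr1 -hu mulrA mulrBr mulr1 -ay subrr !mul0r.
Qed.

(** In the quotient the image of I has square zero, so the Jacobian determinant is 1 + div V; being
    1, it gives div V = 0. *)
Lemma square_quotient I n (psi : polymap A n) : is_ideal I ->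
  pm_id_mod I psi -> \det (jacobian psi) = 1 -> ~ ideal_square I 1 ->
  exists (Q : comNzRingType) (pi : {rmorphism A -> Q}) (I' : Q -> Prop) V,
    [/\ forall y, exists x, pi x = y, forall x, pi x = 0 <-> ideal_square I x
      & [/\ is_ideal I', forall a b, I' a -> I' b -> a * b = 0,
        forall i, coef_in I' (V i), \sum_i (V i)^`M(i) = 0
        & pm_map pi psi = translation V]].
Proof.
move=> iI hpsi hdet sq1.
have [Q [pi [surj ker]]] := exists_quotient (is_ideal_square I) sq1.
pose I' y := exists x, I x /\ pi x = y.
have iI' : is_ideal I'.
  have [I0 ID IM] := iI; split=> [|_ _ [u [Iu <-]] [v [Iv <-]]|r _ [u [Iu <-]]].
  - by exists 0; rewrite rmorph0.
  - by exists (u + v); rewrite rmorphD; split => //; apply: ID.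
  - by have [s <-] := surj r; exists (s * u); rewrite rmorphM; split => //; apply: IM.
have I'2 a b : I' a -> I' b -> a * b = 0.
  move=> [u [Iu <-]] [v [Iv <-]]; rewrite -rmorphM; apply/ker.
  exact: ideal_square_mul.
pose V i := map_mpoly pi (tnth psi i - 'X_i).
have cV i : coef_in I' (V i).
  by move=> m; rewrite /V mcoeff_map_mpoly; exists (tnth psi i - 'X_i)@_m.
have hV : pm_map pi psi = translation V.
  apply: eq_from_tnth => i; rewrite tnth_pm_map tnth_translation /V raddfB /= map_mpoly_Xi.
  by rewrite addrC subrK.
exists Q, pi, I', V; split => //; split => //.
apply: (@addrI _ 1); rewrite addr0 -(det_jacobian_translation iI' I'2 cV) -hV.
by rewrite det_jacobian_map hdet rmorph1.
Qed.

Lemma lift_inverse I (Q : comNzRingType) (pi : {rmorphism A -> Q}) n (psi : polymap A n) :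
  (forall y, exists x, pi x = y) -> (forall x, pi x = 0 <-> I x) ->
  EA (pm_map pi psi) -> exists eps, EA eps /\ pm_id_mod I (pm_comp eps psi).
Proof.
move=> surj ker E; have [chi inv] := EA_GA E.
have [eps [Eeps heps]] := EA_lift1 surj (EA_inv E inv).
exists eps; split => //; apply/(pm_id_modP _ ker).
by rewrite pm_map_comp heps; case: inv.
Qed.

Lemma stable_step I n (psi : polymap A n) : is_ideal I ->
  pm_id_mod I psi -> \det (jacobian psi) = 1 ->
  exists eps, EA eps /\ pm_id_mod (ideal_square I) (pm_comp eps (extend (leqnSn n) psi)).
Proof.
(* If the square is the whole ring, the congruence is void and the quotient would be the zero
   ring. *)
move=> iI hpsi hdet; case: (classic (ideal_square I 1)) => [sq1|nsq1].
  exists (pm_id A n.+1); split; first exact: EA_id.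
  by move=> i m; rewrite -[X in ideal_square I X]mulr1; have [_ _] := is_ideal_square I; apply.
have [Q [pi [I' [V [surj ker [iI' I'2 cV div0 hV]]]]]] := square_quotient iI hpsi hdet nsq1.
apply: (lift_inverse surj ker).
by rewrite pm_map_extend hV; apply: (EA_extend_translation iI' I'2 cV).
Qed.

Lemma rational_step I (psi : polymap A 2) : Q_algebra A -> is_ideal I ->
  pm_id_mod I psi -> \det (jacobian psi) = 1 ->
  exists eps, EA eps /\ pm_id_mod (ideal_square I) (pm_comp eps psi).
Proof.
move=> [f] iI hpsi hdet; case: (classic (ideal_square I 1)) => [sq1|nsq1].
  exists (pm_id A 2); split; first exact: EA_id.
  by move=> i m; rewrite -[X in ideal_square I X]mulr1; have [_ _] := is_ideal_square I; apply.
have [Q [pi [I' [V [surj ker [iI' I'2 cV div0 hV]]]]]] := square_quotient iI hpsi hdet nsq1.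
apply: (lift_inverse surj ker); rewrite hV; apply: (tame_field_plane iI' I'2 _ cV) => //.
by constructor; exact: (pi \o f : {rmorphism rat -> Q}).
Qed.

Lemma EA_of_pm_id_mod0 I n (eps psi : polymap A n) : (forall x, I x -> x = 0) ->
  EA eps -> pm_id_mod I (pm_comp eps psi) -> EA psi.
Proof.
move=> I0 Eeps h; apply: (EA_cancel Eeps).
suff -> : pm_comp eps psi = pm_id A n by apply: EA_id.
apply: eq_from_tnth => i; rewrite tnth_pm_id; apply/eqP; rewrite -subr_eq0.
by apply/eqP/mpolyP => m; rewrite mcoeff0; apply: I0; apply: h.
Qed.

End IdealSquare.

(** A minimal nil ideal with property P coincides with its square, hence is zero. *)
Lemma artinian_nil_minimal (A : comNzRingType) (P : (A -> Prop) -> Prop) I0 :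
  artinian A -> is_ideal I0 -> (forall x, I0 x -> nilpotent_element x) -> P I0 ->
  (forall I, is_ideal I -> P I -> P (ideal_square I)) ->
  exists I, P I /\ forall x, I x -> x = 0.
Proof.
move=> hA iI0 nil0 P0 Psq.
pose P' I := (forall x, I x -> nilpotent_element x) /\ P I.
have [I [iI [nilI PI] Imin]] := @artinian_minimal A hA P' I0 iI0 (conj nil0 P0).
exists I; split => //; apply: (artinian_nil_idempotent hA iI nilI).
apply: Imin; first exact: is_ideal_square.
  by split; [move=> x /(ideal_square_sub iI) /nilI | apply: Psq].
by move=> x; apply: ideal_square_sub.
Qed.

Theorem theorem4p3 (A : comNzRingType) (hA : artinian A)
    (phi : polymap A 2) (hphi : SA phi) :
  (exists m : nat, EA (stabilize m phi)) /\ (Q_algebra A -> EA phi).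
Proof.
have [I0 [eps0 [iI0 nil0 E0 h0]]] := SA2_reduce_nil hA hphi.
have [_ det1] := hphi.
split=> [|hQ].
  (* The number of variables belongs to the predicate, since each squaring of I adds one. *)
  pose P I := exists N (h : (2 <= N)%N) eps,
    EA eps /\ pm_id_mod I (pm_comp eps (extend h phi)).
  have [||I [[N [h [eps [Eeps heps]]]] I00]] := @artinian_nil_minimal A P I0 hA iI0 nil0.
  - by exists 2%N, (leqnn 2), eps0; rewrite extend_self.
  - move=> I iI [N [h [eps [Eeps heps]]]].
    have [|e [Ee he]] := stable_step iI heps.
      by rewrite det_jacobian_comp (det_jacobian_EA Eeps) det_jacobian_extend // comp_mpoly1 mulr1.
    exists N.+1, (leqW h), (pm_comp e (extend (leqnSn N) eps)); split.
      by apply: EA_comp => //; apply: EA_extend.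
    by rewrite -(extend_trans h (leqnSn N)) -pm_compA -extend_comp.
  have := EA_of_pm_id_mod0 I00 Eeps heps.
  (* Writing N as [m.+2] makes it convertible to [2 + m]. *)
  case: N h eps {Eeps heps} => [|[|m]] // h _ E.
  by exists m; rewrite stabilize_extend (bool_irrelevance (leq_addr m 2) h).
pose P I := exists eps, EA eps /\ pm_id_mod I (pm_comp eps phi).
have [||I [[eps [Eeps heps]] I00]] := @artinian_nil_minimal A P I0 hA iI0 nil0.
- by exists eps0.
- move=> I iI [eps [Eeps heps]].
  have [|e [Ee he]] := rational_step hQ iI heps.
    by rewrite det_jacobian_comp (det_jacobian_EA Eeps) det1 comp_mpoly1 mulr1.
  by exists (pm_comp e eps); rewrite -pm_compA; split => //; apply: EA_comp.
exact: EA_of_pm_id_mod0 I00 Eeps heps.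
Qed.
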